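(* Let $L$ be an operadic Lie algebra in $\mathrm{Ver}_4^+$ with bracket $[\cdot,\cdot]$. Then $L$ is a Lie algebra satisfying the PBW theorem if and only if $[x,x]=0$ for all $x\in\ker d\subset L$.
   Context: Let $k$ be an algebraically closed field of characteristic $2$. $\mathrm{Ver}_4^+$ is the symmetric tensor category whose objects are finite-dimensional $k$-vector spaces $V$ with a linear endomorphism $d$, $d^2=0$ (write $x'=dx$); morphisms are linear maps commuting with $d$; on tensor products $d$ acts by $d\otimes 1+1\otimes d$; the braiding is $c(v\otimes w)=w\otimes v+w'\otimes v'$. Ind-objects are allowed where infinite-dimensional objects occur. An operadic Lie algebra in $\mathrm{Ver}_4^+$ is an (ind-)object $L$ with a morphism $\beta:L\otimes L\to L$, $\beta(x\otimes y)=[x,y]$, such that $\beta\circ(\mathrm{id}+c)=0$ and $\beta\circ(\beta\otimes \mathrm{id})\circ(\mathrm{id}+(123)+(132))=0$, where $(123),(132)$ are the cyclic permutations of $L^{\otimes 3}$ defined by the braiding. Explicitly: $[x,y]+[y,x]+[y',x']=0$ and $[[x,y],z]+[[z,x],y]+[[y,z],x]+[[x',y],z']+[[z',x],y']+[[y',z],x']=0$. For an object $V$, $\mathrm{FOLie}(V)=\bigoplus_{n\ge1}\mathrm{FOLie}_n(V)$ is the free operadic Lie algebra on $V$ (left adjoint of the forgetful functor), where $\mathrm{FOLie}_n(V)=(V^{\otimes n}\otimes \mathbf{Lie}_n)_{S_n}$ with $\mathbf{Lie}$ the Lie operad. An associative algebra is an operadic Lie algebra via the (braided) commutator $m\circ(\mathrm{id}-c)$.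 Let $\phi^V=\bigoplus_n\phi^V_n:\mathrm{FOLie}(V)\to TV$ be the morphism of operadic Lie algebras induced by $V\hookrightarrow TV$, and $E_n(V)=\ker\phi^V_n$. An operadic Lie algebra $L$ is called a Lie algebra if the map $\beta^L:\mathrm{FOLie}(L)\to L$ induced by $\mathrm{id}_L$ vanishes on $E_n(L)$ for all $n$. The universal enveloping algebra is $U(L)=TL/(\mathrm{im}(\mathrm{id}-c-\beta))$, with the filtration induced from $TL$. $L$ satisfies the PBW theorem if the natural map $\eta:\mathrm{Sym}\,L\to\operatorname{gr}U(L)$ is an isomorphism, where $\mathrm{Sym}\,L=TL/(\mathrm{im}(c-\mathrm{id}))$. *)

(* Defs.v *)
From HB Require Import structures.
From mathcomp Require Import all_boot all_algebra.
From mathcomp Require Import ssrAC generic_quotient ring_quotient boolp.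

Set Implicit Arguments.
Unset Strict Implicit.
Unset Printing Implicit Defensive.

Import GRing.Theory.
Local Open Scope ring_scope.
Local Open Scope quotient_scope.

HB.mixin Record hasChar2 k of GRing.ClosedField k := {
  char2 : 2%N \in [pchar k]
}.

#[short(type="char2ClosedFieldType")]
HB.structure Definition Char2ClosedField :=
  {k of GRing.ClosedField k & hasChar2 k}.

Lemma addvv (k : char2ClosedFieldType) (V : lmodType k) (x : V) : x + x = 0.
Proof.
by rewrite -mulr2n -scaler_nat (pcharf0 (@char2 k)) scale0r.
Qed.

Lemma oppv (k : char2ClosedFieldType) (V : lmodType k) (x : V) : - x = x.
Proof. by apply/esym/eqP; rewrite -addr_eq0 addvv. Qed.

(* Objects of Ver_4^+ and its ind-completion: there is no finiteness condition.
   The differential vd x is written x' in the comments. *)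
HB.mixin Record isVer4 (k : char2ClosedFieldType) V of GRing.Lmodule k V := {
  vd : V -> V;
  vd_is_linear : linear vd;
  vdd : forall x, vd (vd x) = 0
}.

#[short(type="ver4Type")]
HB.structure Definition Ver4 (k : char2ClosedFieldType) :=
  {V of GRing.Lmodule k V & isVer4 k V}.

HB.instance Definition _ (k : char2ClosedFieldType) (V : ver4Type k) :=
  GRing.isLinear.Build k V V *:%R (@vd k V) (@vd_is_linear k V).

HB.mixin Record isVer4Alg (k : char2ClosedFieldType) A of GRing.Algebra k A & Ver4 k A := {
  vdM : forall a b : A, vd (a * b) = vd a * b + a * vd b
}.

#[short(type="ver4AlgType")]
HB.structure Definition Ver4Alg (k : char2ClosedFieldType) :=
  {A of GRing.Algebra k A & Ver4 k A & isVer4Alg k A}.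

(* m o c on pure tensors, for the braiding c(a (x) b) = b (x) a + b' (x) a' *)
Definition mulc (k : char2ClosedFieldType) (A : ver4AlgType k) (a b : A) : A :=
  b * a + vd b * vd a.

HB.mixin Record isOLie (k : char2ClosedFieldType) L of Ver4 k L := {
  lb : L -> L -> L;
  lb_linearl : forall y, linear (lb^~ y);
  lb_linearr : forall x, linear (lb x);
  vd_lb : forall x y, vd (lb x y) = lb (vd x) y + lb x (vd y);
  lb_anti : forall x y, lb x y + lb y x + lb (vd y) (vd x) = 0;
  lb_jacobi : forall x y z,
    lb (lb x y) z + lb (lb z x) y + lb (lb y z) x
    + lb (lb (vd x) y) (vd z) + lb (lb (vd z) x) (vd y)
    + lb (lb (vd y) z) (vd x) = 0
}.

#[short(type="olieType")]
HB.structure Definition OLie (k : char2ClosedFieldType) :=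
  {L of Ver4 k L & isOLie k L}.

Section OLieTheory.
Variables (k : char2ClosedFieldType) (L : olieType k).
Implicit Types x y : L.

Lemma lbDl x1 x2 y : lb (x1 + x2) y = lb x1 y + lb x2 y.
Proof. by have := lb_linearl y 1 x1 x2; rewrite !scale1r. Qed.

Lemma lbDr x y1 y2 : lb x (y1 + y2) = lb x y1 + lb x y2.
Proof. by have := lb_linearr x 1 y1 y2; rewrite !scale1r. Qed.

Lemma lb0l y : lb 0 y = 0 :> L.
Proof. by apply: (addrI (lb 0 y)); rewrite -lbDl !addr0. Qed.

Lemma lb0r x : lb x 0 = 0 :> L.
Proof. by apply: (addrI (lb x 0)); rewrite -lbDr !addr0. Qed.

Lemma lbZl a x y : lb (a *: x) y = a *: lb x y.
Proof. by have := lb_linearl y a x 0; rewrite lb0l !addr0. Qed.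

Lemma lbZr a x y : lb x (a *: y) = a *: lb x y.
Proof. by have := lb_linearr x a y 0; rewrite lb0r !addr0. Qed.

End OLieTheory.

Section Subobjects.
Variables (k : char2ClosedFieldType) (V : ver4Type k).

Record subobj := SubObj {
  so_mem :> V -> Prop;
  so0 : so_mem 0;
  soD : forall x y, so_mem x -> so_mem y -> so_mem (x + y);
  soZ : forall a x, so_mem x -> so_mem (a *: x);
  so_vd : forall x, so_mem x -> so_mem (vd x)
}.

Variable S : subobj.

Definition so_pred : {pred V} := fun x => `[< S x >].

Lemma so_predP x : reflect (S x) (x \in so_pred).
Proof. exact: asboolP. Qed.

Lemma soN x : S x -> S (- x).
Proof. by rewrite -scaleN1r; apply: soZ. Qed.

Lemma soB x y : S x -> S y -> S (x - y).
Proof. by move=> Sx Sy; apply: soD => //; apply: soN. Qed.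

Lemma so_submod_closed : submod_closed so_pred.
Proof.
split; first by apply/so_predP; exact: so0.
move=> a x y /so_predP Sx /so_predP Sy; apply/so_predP.
by apply: soD => //; apply: soZ.
Qed.

HB.instance Definition _ := GRing.isSubmodClosed.Build k V so_pred so_submod_closed.

Definition sub_of := {x : V | x \in so_pred}.

HB.instance Definition _ := [isSub of sub_of for @sval _ _].
HB.instance Definition _ := [Choice of sub_of by <:].
HB.instance Definition _ := [SubChoice_isSubLmodule of sub_of by <:].

Definition sub_mk (x : V) (Sx : S x) : sub_of := Sub x (introT (so_predP x) Sx).

Lemma val_sub_mk x (Sx : S x) : val (sub_mk Sx) = x.
Proof. exact: SubK. Qed.

Lemma subP (x : sub_of) : S (val x).
Proof. exact/so_predP/(valP x). Qed.

Definition sub_vd (x : sub_of) : sub_of := sub_mk (so_vd (subP x)).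

Lemma sub_vd_linear : linear sub_vd.
Proof. by move=> a x y; apply: val_inj; rewrite /= !linearP. Qed.

Lemma sub_vdd x : sub_vd (sub_vd x) = 0.
Proof. by apply: val_inj; rewrite /= vdd. Qed.

HB.instance Definition _ := isVer4.Build k sub_of sub_vd_linear sub_vdd.

Definition quot_of := Quotient.quot so_pred.

HB.instance Definition _ := GRing.Zmodule.on quot_of.

Definition qpi (x : V) : quot_of := \pi_(Quotient.quot so_pred) x.

Lemma qpi_eqP x y : qpi x = qpi y <-> S (x - y).
Proof.
split=> [/eqP|Sxy]; first by rewrite -Quotient.idealrBE => /so_predP.
by apply/eqP; rewrite -Quotient.idealrBE; apply/so_predP.
Qed.

Lemma qpi0P x : qpi x = 0 <-> S x.
Proof.
have -> : 0 = qpi 0 by rewrite /qpi; apply/esym; rewrite piE.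
by rewrite qpi_eqP subr0.
Qed.

Lemma qpi_surj (q : quot_of) : exists x, q = qpi x.
Proof. by exists (repr q); rewrite /qpi reprK. Qed.

Lemma qpiD : {morph qpi : x y / x + y}.
Proof. by move=> x y; rewrite /qpi piE. Qed.

Definition qscale a (q : quot_of) : quot_of := qpi (a *: repr q).

Lemma qpiZ a x : qpi (a *: x) = qscale a (qpi x).
Proof.
apply/qpi_eqP; rewrite -scalerBr; apply: soZ; apply/qpi_eqP.
by rewrite /qpi reprK.
Qed.

Lemma qscaleA a b q : qscale a (qscale b q) = qscale (a * b) q.
Proof. by have [x ->] := qpi_surj q; rewrite -!qpiZ scalerA. Qed.

Lemma qscale1 : left_id 1 qscale.
Proof. by move=> q; have [x ->] := qpi_surj q; rewrite -qpiZ scale1r. Qed.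

Lemma qscaleDr : right_distributive qscale +%R.
Proof.
move=> a p q; have [x ->] := qpi_surj p; have [y ->] := qpi_surj q.
by rewrite -qpiD -!qpiZ scalerDr qpiD.
Qed.

Lemma qscaleDl q : {morph qscale^~ q : a b / a + b}.
Proof. by move=> a b; have [x ->] := qpi_surj q; rewrite -!qpiZ scalerDl qpiD. Qed.

HB.instance Definition _ := GRing.Zmodule_isLmodule.Build k quot_of
  qscaleA qscale1 qscaleDr qscaleDl.

Lemma qpi_is_linear : linear qpi.
Proof. by move=> a x y; rewrite qpiD qpiZ. Qed.

HB.instance Definition _ := GRing.isLinear.Build k V quot_of *:%R qpi qpi_is_linear.

Definition qvd (q : quot_of) : quot_of := qpi (vd (repr q)).

Lemma qpi_vd x : qpi (vd x) = qvd (qpi x).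
Proof.
apply/qpi_eqP; rewrite -raddfB; apply: so_vd; apply/qpi_eqP.
by rewrite /qpi reprK.
Qed.

Lemma qvd_linear : linear qvd.
Proof.
move=> a p q; have [x ->] := qpi_surj p; have [y ->] := qpi_surj q.
by rewrite -linearP -!qpi_vd !linearP.
Qed.

Lemma qvdd q : qvd (qvd q) = 0.
Proof. by have [x ->] := qpi_surj q; rewrite -!qpi_vd vdd raddf0. Qed.

HB.instance Definition _ := isVer4.Build k quot_of qvd_linear qvdd.

Lemma vd_qpi x : vd (qpi x) = qpi (vd x).
Proof. by rewrite qpi_vd. Qed.

End Subobjects.

Section PreimageSubobject.
Variables (k : char2ClosedFieldType) (V : ver4Type k) (S T : subobj V).

Definition so_restrict : subobj (sub_of S).
Proof.
exists (fun x => T (val x)) => [|x y|a x|x] /=.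
- exact: so0.
- exact: soD.
- exact: soZ.
- exact: so_vd.
Defined.

End PreimageSubobject.

(* A two-sided ideal in the category of algebras in Ver_4^+, assumed proper
   because library algebras are nontrivial. *)
Record dideal (k : char2ClosedFieldType) (A : ver4AlgType k) := DIdeal {
  di_so :> subobj A;
  di_mull : forall a x, di_so x -> di_so (a * x);
  di_mulr : forall a x, di_so x -> di_so (x * a);
  di_proper : ~ di_so 1
}.

Section AlgebraQuotient.
Variables (k : char2ClosedFieldType) (A : ver4AlgType k) (I : dideal A).

Definition alg_quot := quot_of I.

HB.instance Definition _ := Ver4.on alg_quot.

Local Notation pi := (@qpi k A I : A -> alg_quot).

Definition aq1 : alg_quot := pi 1.
Definition aqmul (p q : alg_quot) : alg_quot := pi (repr p * repr q).

Lemma aq_mulE a b : aqmul (pi a) (pi b) = pi (a * b).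
Proof.
apply/esym/qpi_eqP.
set a' := repr _; set b' := repr _.
have Ia : I (a - a') by apply/qpi_eqP; rewrite /qpi reprK.
have Ib : I (b - b') by apply/qpi_eqP; rewrite /qpi reprK.
have -> : a * b - a' * b' = (a - a') * b + a' * (b - b').
  by rewrite mulrBl mulrBr addrA addrNK.
by apply: soD; [exact: di_mulr | exact: di_mull].
Qed.

Lemma aq_mulA : associative aqmul.
Proof.
move=> p q r; have [a ->] := qpi_surj p; have [b ->] := qpi_surj q.
by have [c ->] := qpi_surj r; rewrite !aq_mulE mulrA.
Qed.

Lemma aq_mul1 : left_id aq1 aqmul.
Proof. by move=> p; have [a ->] := qpi_surj p; rewrite aq_mulE mul1r. Qed.

Lemma aq_1mul : right_id aq1 aqmul.
Proof. by move=> p; have [a ->] := qpi_surj p; rewrite aq_mulE mulr1. Qed.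

Lemma aq_mulDl : left_distributive aqmul +%R.
Proof.
move=> p q r; have [a ->] := qpi_surj p; have [b ->] := qpi_surj q.
by have [c ->] := qpi_surj r; rewrite -raddfD !aq_mulE mulrDl raddfD.
Qed.

Lemma aq_mulDr : right_distributive aqmul +%R.
Proof.
move=> p q r; have [a ->] := qpi_surj p; have [b ->] := qpi_surj q.
by have [c ->] := qpi_surj r; rewrite -raddfD !aq_mulE mulrDr raddfD.
Qed.

Lemma aq_1neq0 : aq1 != 0.
Proof. by apply/eqP => /qpi0P; exact: di_proper. Qed.

HB.instance Definition _ := GRing.Zmodule_isNzRing.Build alg_quot
  aq_mulA aq_mul1 aq_1mul aq_mulDl aq_mulDr aq_1neq0.

Lemma aq_piM a b : pi a * pi b = pi (a * b).
Proof. exact: aq_mulE. Qed.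

Lemma aq_scaleAl (c : k) (p q : alg_quot) : c *: (p * q) = (c *: p) * q.
Proof.
have [a ->] := qpi_surj p; have [b ->] := qpi_surj q.
rewrite -[c *: pi a](linearZ_LR (qpi I)) !aq_piM.
by rewrite -[LHS](linearZ_LR (qpi I)) scalerAl.
Qed.

HB.instance Definition _ := GRing.Lmodule_isLalgebra.Build k alg_quot aq_scaleAl.

Lemma aq_scaleAr (c : k) (p q : alg_quot) : c *: (p * q) = p * (c *: q).
Proof.
have [a ->] := qpi_surj p; have [b ->] := qpi_surj q.
rewrite -[c *: pi b](linearZ_LR (qpi I)) !aq_piM.
by rewrite -[LHS](linearZ_LR (qpi I)) scalerAr.
Qed.

HB.instance Definition _ := GRing.Lalgebra_isAlgebra.Build k alg_quot aq_scaleAr.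

Definition aqpi (a : A) : alg_quot := pi a.

HB.instance Definition _ := GRing.Linear.copy aqpi (@qpi k A I).

Lemma aqpi_monoid : monoid_morphism aqpi.
Proof. by split=> // a b; rewrite [RHS]aq_mulE. Qed.

HB.instance Definition _ := GRing.isMonoidMorphism.Build A alg_quot aqpi aqpi_monoid.

Lemma vd_aqpi a : vd (aqpi a) = aqpi (vd a).
Proof. exact: vd_qpi. Qed.

Lemma aqpi_surj (p : alg_quot) : exists a, p = aqpi a.
Proof. exact: qpi_surj. Qed.

Lemma aq_vdM (p q : alg_quot) : vd (p * q) = vd p * q + p * vd q.
Proof.
have [a ->] := aqpi_surj p; have [b ->] := aqpi_surj q.
by rewrite -(rmorphM (aqpi)) !vd_aqpi -!(rmorphM (aqpi)) -(rmorphD (aqpi)) vdM.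
Qed.

HB.instance Definition _ := isVer4Alg.Build k alg_quot aq_vdM.

End AlgebraQuotient.

(* The tensor algebra TV, presented as the free associative unital algebra on
   the vector space V: formal expressions modulo the smallest congruence that
   forces the axioms of k-algebras and the linearity of the generators. *)
Inductive tterm (k : char2ClosedFieldType) (V : ver4Type k) : Type :=
| tgen of V
| tzero
| tone
| tadd of tterm V & tterm V
| tscale of k & tterm V
| tmul of tterm V & tterm V.

Arguments tzero {k V}.
Arguments tone {k V}.

HB.instance Definition _ k (V : ver4Type k) := gen_eqMixin (tterm V).
HB.instance Definition _ k (V : ver4Type k) := gen_choiceMixin (tterm V).

Inductive tcong (k : char2ClosedFieldType) (V : ver4Type k) : tterm V -> tterm V -> Prop :=
| tc_refl t : tcong t t
| tc_sym t u : tcong t u -> tcong u t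
| tc_trans t u v : tcong t u -> tcong u v -> tcong t v
| tc_add t t' u u' : tcong t t' -> tcong u u' -> tcong (tadd t u) (tadd t' u')
| tc_scale a t t' : tcong t t' -> tcong (tscale a t) (tscale a t')
| tc_mul t t' u u' : tcong t t' -> tcong u u' -> tcong (tmul t u) (tmul t' u')
| tc_addA t u v : tcong (tadd t (tadd u v)) (tadd (tadd t u) v)
| tc_addC t u : tcong (tadd t u) (tadd u t)
| tc_add0 t : tcong (tadd tzero t) t
| tc_scale0 t : tcong (tscale 0 t) tzero
| tc_scale1 t : tcong (tscale 1 t) t
| tc_scaleA a b t : tcong (tscale a (tscale b t)) (tscale (a * b) t)
| tc_scaleDr a t u : tcong (tscale a (tadd t u)) (tadd (tscale a t) (tscale a u))
| tc_scaleDl a b t : tcong (tscale (a + b) t) (tadd (tscale a t) (tscale b t))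
| tc_mulA t u v : tcong (tmul t (tmul u v)) (tmul (tmul t u) v)
| tc_1mul t : tcong (tmul tone t) t
| tc_mul1 t : tcong (tmul t tone) t
| tc_mulDl t u v : tcong (tmul (tadd t u) v) (tadd (tmul t v) (tmul u v))
| tc_mulDr t u v : tcong (tmul t (tadd u v)) (tadd (tmul t u) (tmul t v))
| tc_scaleAl a t u : tcong (tscale a (tmul t u)) (tmul (tscale a t) u)
| tc_scaleAr a t u : tcong (tscale a (tmul t u)) (tmul t (tscale a u))
| tc_genD x y : tcong (tgen (x + y)) (tadd (tgen x) (tgen y))
| tc_genZ a x : tcong (tgen (a *: x)) (tscale a (tgen x)).

Section TermEvaluation.
Variables (k : char2ClosedFieldType) (V : ver4Type k) (R : nzRingType).
Variables (s : {rmorphism k -> R}) (f : V -> R).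
Hypothesis s_central : forall a r, s a * r = r * s a.
Hypothesis fD : {morph f : x y / x + y}.
Hypothesis fZ : forall a x, f (a *: x) = s a * f x.

Fixpoint teval (t : tterm V) : R :=
  match t with
  | tgen x => f x
  | tzero => 0
  | tone => 1
  | tadd t u => teval t + teval u
  | tscale a t => s a * teval t
  | tmul t u => teval t * teval u
  end.

Lemma teval_cong t u : tcong t u -> teval t = teval u.
Proof.
elim=> {t u} /=.
- by [].
- by move=> t u _ ->.
- by move=> t u v _ -> _ ->.
- by move=> t t' u u' _ -> _ ->.
- by move=> a t t' _ ->.
- by move=> t t' u u' _ -> _ ->.
- by move=> t u v; rewrite addrA.
- by move=> t u; rewrite addrC.
- by move=> t; rewrite add0r.
- by move=> t; rewrite rmorph0 mul0r.
- by move=> t; rewrite rmorph1 mul1r.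
- by move=> a b t; rewrite rmorphM mulrA.
- by move=> a t u; rewrite mulrDr.
- by move=> a b t; rewrite rmorphD mulrDl.
- by move=> t u v; rewrite mulrA.
- by move=> t; rewrite mul1r.
- by move=> t; rewrite mulr1.
- by move=> t u v; rewrite mulrDl.
- by move=> t u v; rewrite mulrDr.
- by move=> a t u; rewrite mulrA.
- by move=> a t u; rewrite !mulrA s_central.
- by move=> x y; rewrite fD.
- by move=> a x; rewrite fZ.
Qed.

End TermEvaluation.

Section TensorAlgebra.
Variables (k : char2ClosedFieldType) (V : ver4Type k).

Definition teqv (t u : tterm V) : bool := `[< tcong t u >].

Lemma teqv_equiv : equiv_class_of teqv.
Proof.
split=> [t|t u|u t v].
- exact/asboolP/tc_refl.
- by apply/asboolP/asboolP; apply: tc_sym.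
- by move=> /asboolP tu /asboolP uv; apply/asboolP; apply: tc_trans tu uv.
Qed.

Canonical teqv_rel := EquivRelPack teqv_equiv.

Definition tensor_alg := {eq_quot teqv_rel}.

HB.instance Definition _ := Choice.on tensor_alg.

Definition tcl (t : tterm V) : tensor_alg := \pi_{eq_quot teqv_rel} t.

Lemma tcl_eqP t u : tcl t = tcl u <-> tcong t u.
Proof. by split=> [/eqmodP/asboolP|/asboolP tu] //; apply/eqmodP. Qed.

Lemma tcl_surj (a : tensor_alg) : exists t, a = tcl t.
Proof. by exists (repr a); rewrite /tcl reprK. Qed.

Lemma tcl_repr t : tcong (repr (tcl t)) t.
Proof. by apply/tcl_eqP; rewrite /tcl reprK. Qed.

Definition ta_add (a b : tensor_alg) := tcl (tadd (repr a) (repr b)).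
Definition ta_scale c (a : tensor_alg) := tcl (tscale c (repr a)).
Definition ta_mul (a b : tensor_alg) := tcl (tmul (repr a) (repr b)).
Definition ta_opp := ta_scale (-1).

Lemma tclD t u : ta_add (tcl t) (tcl u) = tcl (tadd t u).
Proof. by apply/tcl_eqP/tc_add; apply: tcl_repr. Qed.
Lemma tclZ c t : ta_scale c (tcl t) = tcl (tscale c t).
Proof. by apply/tcl_eqP/tc_scale; apply: tcl_repr. Qed.
Lemma tclM t u : ta_mul (tcl t) (tcl u) = tcl (tmul t u).
Proof. by apply/tcl_eqP/tc_mul; apply: tcl_repr. Qed.

Ltac tlift := repeat (let a := fresh in let t := fresh in
    move=> a; case: (tcl_surj a) => t ->);
  rewrite ?(tclD, tclZ, tclM).

Lemma ta_addA : associative ta_add.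
Proof. by tlift; apply/tcl_eqP/tc_addA. Qed.
Lemma ta_addC : commutative ta_add.
Proof. by tlift; apply/tcl_eqP/tc_addC. Qed.
Lemma ta_add0 : left_id (tcl tzero) ta_add.
Proof. by tlift; apply/tcl_eqP/tc_add0. Qed.
Lemma ta_addN : left_inverse (tcl tzero) ta_opp ta_add.
Proof.
move=> a; case: (tcl_surj a) => t ->; rewrite /ta_opp tclZ tclD.
apply/tcl_eqP; apply: tc_trans (tc_scale0 t).
rewrite -(addNr 1); apply: tc_trans (tc_sym (tc_scaleDl _ _ _)).
by apply: tc_add; [apply: tc_refl | apply/tc_sym/tc_scale1].
Qed.

HB.instance Definition _ := GRing.isZmodule.Build tensor_alg
  ta_addA ta_addC ta_add0 ta_addN.

Lemma ta_scaleA a b v : ta_scale a (ta_scale b v) = ta_scale (a * b) v.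
Proof. by move: v; tlift; apply/tcl_eqP/tc_scaleA. Qed.
Lemma ta_scale1 : left_id 1 ta_scale.
Proof. by tlift; apply/tcl_eqP/tc_scale1. Qed.
Lemma ta_scaleDr : right_distributive ta_scale ta_add.
Proof. by move=> a; tlift; apply/tcl_eqP/tc_scaleDr. Qed.
Lemma ta_scaleDl v : {morph ta_scale^~ v : a b / a + b >-> ta_add a b}.
Proof. by move=> a b; move: v; tlift; apply/tcl_eqP/tc_scaleDl. Qed.

HB.instance Definition _ := GRing.Zmodule_isLmodule.Build k tensor_alg
  ta_scaleA ta_scale1 ta_scaleDr ta_scaleDl.

Lemma ta_mulA : associative ta_mul.
Proof. by tlift; apply/tcl_eqP/tc_mulA. Qed.
Lemma ta_1mul : left_id (tcl tone) ta_mul.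
Proof. by tlift; apply/tcl_eqP/tc_1mul. Qed.
Lemma ta_mul1 : right_id (tcl tone) ta_mul.
Proof. by tlift; apply/tcl_eqP/tc_mul1. Qed.
Lemma ta_mulDl : left_distributive ta_mul ta_add.
Proof. by tlift; apply/tcl_eqP/tc_mulDl. Qed.
Lemma ta_mulDr : right_distributive ta_mul ta_add.
Proof. by tlift; apply/tcl_eqP/tc_mulDr. Qed.
Lemma ta_1neq0 : tcl tone != tcl tzero.
Proof.
apply/eqP => /tcl_eqP.
move=> /(teval_cong (s := idfun) (f := fun=> 0) (@mulrC _)) /= H.
by have /eqP := oner_neq0 k; apply; apply: H => [x y|a x]; rewrite ?addr0 ?mulr0.
Qed.

HB.instance Definition _ := GRing.Zmodule_isNzRing.Build tensor_alg
  ta_mulA ta_1mul ta_mul1 ta_mulDl ta_mulDr ta_1neq0.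

Lemma ta_scaleAl a (u v : tensor_alg) : a *: (u * v) = (a *: u) * v.
Proof.
case: (tcl_surj u) => t ->; case: (tcl_surj v) => t' ->.
rewrite -[LHS]/(ta_scale _ (ta_mul _ _)) -[RHS]/(ta_mul (ta_scale _ _) _).
by rewrite ?(tclZ, tclM); apply/tcl_eqP/tc_scaleAl.
Qed.

HB.instance Definition _ := GRing.Lmodule_isLalgebra.Build k tensor_alg ta_scaleAl.

Lemma ta_scaleAr a (u v : tensor_alg) : a *: (u * v) = u * (a *: v).
Proof.
case: (tcl_surj u) => t ->; case: (tcl_surj v) => t' ->.
rewrite -[LHS]/(ta_scale _ (ta_mul _ _)) -[RHS]/(ta_mul _ (ta_scale _ _)).
by rewrite ?(tclZ, tclM); apply/tcl_eqP/tc_scaleAr.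
Qed.

HB.instance Definition _ := GRing.Lalgebra_isAlgebra.Build k tensor_alg ta_scaleAr.

Lemma tcl0 : tcl tzero = 0. Proof. by []. Qed.
Lemma tcl1 : tcl tone = 1. Proof. by []. Qed.
Lemma tcl_add t u : tcl (tadd t u) = tcl t + tcl u.
Proof. by rewrite -tclD. Qed.
Lemma tcl_scale a t : tcl (tscale a t) = a *: tcl t.
Proof. by rewrite -tclZ. Qed.
Lemma tcl_mul t u : tcl (tmul t u) = tcl t * tcl u.
Proof. by rewrite -tclM. Qed.

Definition tclE := (tcl0, tcl1, tcl_add, tcl_scale, tcl_mul).

Definition tin (x : V) : tensor_alg := tcl (tgen x).

Lemma tin_is_linear : linear tin.
Proof.
move=> a x y; rewrite /tin -tcl_scale -tcl_add; apply/tcl_eqP.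
apply: tc_trans (tc_genD _ _) _.
by apply: tc_add; [apply: tc_genZ | apply: tc_refl].
Qed.

HB.instance Definition _ := GRing.isLinear.Build k V tensor_alg *:%R tin tin_is_linear.

Lemma tensor_ind (P : tensor_alg -> Prop) :
  (forall x, P (tin x)) -> P 0 -> P 1 ->
  (forall a b, P a -> P b -> P (a + b)) ->
  (forall c a, P a -> P (c *: a)) ->
  (forall a b, P a -> P b -> P (a * b)) -> forall a, P a.
Proof.
move=> Pg P0 P1 PD PZ PM a; case: (tcl_surj a) => t -> {a}.
by elim: t => [x|||t Pt u Pu|c t Pt|t Pt u Pu];
  rewrite ?tclE; [apply: Pg | | | apply: PD | apply: PZ | apply: PM].
Qed.

(* d (x) 1 + 1 (x) d on tensor powers: the derivation extending d *)
Fixpoint tdiff (t : tterm V) : tensor_alg :=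
  match t with
  | tgen x => tin (vd x)
  | tzero | tone => 0
  | tadd t u => tdiff t + tdiff u
  | tscale a t => a *: tdiff t
  | tmul t u => tdiff t * tcl u + tcl t * tdiff u
  end.

Lemma tdiff_cong t u : tcong t u -> tdiff t = tdiff u.
Proof.
elim=> {t u} /=.
- by [].
- by move=> t u _ ->.
- by move=> t u v _ -> _ ->.
- by move=> t t' u u' _ -> _ ->.
- by move=> a t t' _ ->.
- by move=> t t' u u' /tcl_eqP -> -> /tcl_eqP -> ->.
- by move=> t u v; rewrite addrA.
- by move=> t u; rewrite addrC.
- by move=> t; rewrite add0r.
- by move=> t; rewrite scale0r.
- by move=> t; rewrite scale1r.
- by move=> a b t; rewrite scalerA.
- by move=> a t u; rewrite scalerDr.
- by move=> a b t; rewrite scalerDl.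
- by move=> t u v; rewrite !tclE !(mulrDl, mulrDr) !mulrA addrA.
- by move=> t; rewrite tclE mul0r mul1r add0r.
- by move=> t; rewrite tclE mulr0 mulr1 addr0.
- by move=> t u v; rewrite !tclE !mulrDl addrACA.
- by move=> t u v; rewrite !tclE !mulrDr addrACA.
- by move=> a t u; rewrite tclE scalerDr !scalerAl.
- by move=> a t u; rewrite tclE scalerDr !scalerAr.
- by move=> x y; rewrite !raddfD.
- by move=> a x; rewrite !linearZ.
Qed.

Definition ta_vd (a : tensor_alg) : tensor_alg := tdiff (repr a).

Lemma ta_vdE t : ta_vd (tcl t) = tdiff t.
Proof. exact/tdiff_cong/tcl_repr. Qed.

Lemma ta_vd_linear : linear ta_vd.
Proof.
move=> c a b; case: (tcl_surj a) => t ->; case: (tcl_surj b) => u ->.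
by rewrite -tcl_scale -tcl_add !ta_vdE.
Qed.

Lemma ta_vd_tin x : ta_vd (tin x) = tin (vd x).
Proof. by rewrite ta_vdE. Qed.

Lemma ta_vd_mul a b : ta_vd (a * b) = ta_vd a * b + a * ta_vd b.
Proof.
case: (tcl_surj a) => t ->; case: (tcl_surj b) => u ->.
by rewrite -tcl_mul !ta_vdE.
Qed.

Lemma ta_vdd a : ta_vd (ta_vd a) = 0.
Proof.
have vd0 : ta_vd 0 = 0 by rewrite -tcl0 ta_vdE.
elim/tensor_ind: a => [x|||a b Ha Hb|c a Ha|a b Ha Hb].
- by rewrite !ta_vd_tin vdd raddf0.
- by rewrite !vd0.
- by rewrite -tcl1 ta_vdE vd0.
- by rewrite -[a]scale1r !ta_vd_linear Ha Hb scaler0 addr0.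
- by rewrite -[_ *: _]addr0 !ta_vd_linear Ha !vd0 scaler0 addr0.
- rewrite ta_vd_mul -[_ * b]scale1r ta_vd_linear !ta_vd_mul Ha Hb.
  by rewrite scale1r mul0r mulr0 add0r addr0 addvv.
Qed.

HB.instance Definition _ := isVer4.Build k (tensor_alg) ta_vd_linear ta_vdd.
HB.instance Definition _ := isVer4Alg.Build k (tensor_alg) ta_vd_mul.

Lemma vd_tin x : vd (tin x) = tin (vd x).
Proof. exact: ta_vd_tin. Qed.

(* TV is the free algebra on V: existence, and uniqueness is tensor_ind. *)
Section Universal.
Variables (R : nzRingType) (s : {rmorphism k -> R}) (f : V -> R).
Hypothesis s_central : forall a r, s a * r = r * s a.
Hypothesis fD : {morph f : x y / x + y}.
Hypothesis fZ : forall a x, f (a *: x) = s a * f x.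

Definition tlift (a : tensor_alg) : R := teval s f (repr a).

Let tliftE t : tlift (tcl t) = teval s f t.
Proof. exact/(teval_cong s_central fD fZ)/tcl_repr. Qed.

Lemma tlift_tin x : tlift (tin x) = f x.
Proof. by rewrite tliftE. Qed.

Lemma tlift0 : tlift 0 = 0.
Proof. by rewrite -tcl0 tliftE. Qed.

Lemma tlift1 : tlift 1 = 1.
Proof. by rewrite -tcl1 tliftE. Qed.

Lemma tliftD : {morph tlift : a b / a + b}.
Proof.
move=> a b; case: (tcl_surj a) => t ->; case: (tcl_surj b) => u ->.
by rewrite -tcl_add !tliftE.
Qed.

Lemma tliftZ c a : tlift (c *: a) = s c * tlift a.
Proof. by case: (tcl_surj a) => t ->; rewrite -tcl_scale !tliftE. Qed.

Lemma tliftM : {morph tlift : a b / a * b}.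
Proof.
move=> a b; case: (tcl_surj a) => t ->; case: (tcl_surj b) => u ->.
by rewrite -tcl_mul !tliftE.
Qed.

End Universal.

End TensorAlgebra.

Arguments tin {k V} x.

(* The span of the products x_1 ... x_n of elements of V with n in P:
   T^n V for P = pred1 n, and the sum of the T^i V with i <= n (resp. i < n)
   for P = [pred i | i <= n] (resp. [pred i | i < n]). *)
Inductive tspan (k : char2ClosedFieldType) (V : ver4Type k) (P : pred nat) :
    tensor_alg V -> Prop :=
| tspan_word (s : seq V) : P (size s) -> tspan P (\prod_(x <- s) tin x)
| tspan0 : tspan P 0
| tspanD a b : tspan P a -> tspan P b -> tspan P (a + b)
| tspanZ c a : tspan P a -> tspan P (c *: a).

Section TensorSpan.
Variables (k : char2ClosedFieldType) (V : ver4Type k).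
Implicit Types (P Q T : pred nat) (a b : tensor_alg V).

Lemma tspan_sub P Q a : subpred P Q -> tspan P a -> tspan Q a.
Proof.
move=> PQ; elim=> {a} [s /PQ|||c a _]; [exact: tspan_word|exact: tspan0| |].
  by move=> a b _ Pa _ Pb; apply: tspanD.
exact: tspanZ.
Qed.

Lemma tspan_mul P Q T a b : (forall m n, P m -> Q n -> T (m + n)%N) ->
  tspan P a -> tspan Q b -> tspan T (a * b).
Proof.
move=> PQT + Qb; elim=> {a} [s Ps||a a' _ Ha _ Ha'|c a _ Ha].
- elim: Qb => {b} [s' Qs'||b b' _ Hb _ Hb'|c b _ Hb].
  + by rewrite -big_cat; apply: tspan_word; rewrite size_cat; apply: PQT.
  + by rewrite mulr0; apply: tspan0.
  + by rewrite mulrDr; apply: tspanD.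
  + by rewrite -scalerAr; apply: tspanZ.
- by rewrite mul0r; apply: tspan0.
- by rewrite mulrDl; apply: tspanD.
- by rewrite -scalerAl; apply: tspanZ.
Qed.

Lemma tspan_tin x : tspan (pred1 1%N) (tin x : tensor_alg V).
Proof.
have -> : tin x = \prod_(y <- [:: x]) tin y by rewrite big_seq1.
by apply: tspan_word.
Qed.

Lemma tspan_predT a : tspan predT a.
Proof.
elim/tensor_ind: a => [x|||a b|c a|a b].
- exact: tspan_sub (tspan_tin x).
- exact: tspan0.
- rewrite -(big_nil 1%R *%R predT (@tin k V)).
  exact: tspan_word.
- exact: tspanD.
- exact: tspanZ.
- exact: tspan_mul.
Qed.

Lemma tspan_vd P a : tspan P a -> tspan P (vd a).
Proof.
elim=> {a} [s||a b _ Ha _ Hb|c a _ Ha]; last 3 first.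
- by rewrite raddf0; apply: tspan0.
- by rewrite raddfD; apply: tspanD.
- by rewrite linearZ; apply: tspanZ.
move=> Ps; apply: (@tspan_sub (pred1 (size s))) => [n /eqP->//|].
elim: s {Ps} => [|x s IH].
  rewrite big_nil; suff -> : vd 1 = 0 :> tensor_alg V by apply: tspan0.
  by have := vdM (1 : tensor_alg V) 1; rewrite !mul1r mulr1 addvv.
rewrite big_cons vdM vd_tin; apply: tspanD.
  have -> : tin (vd x) * \prod_(y <- s) tin y = \prod_(y <- vd x :: s) tin y.
    by rewrite big_cons.
  by apply: tspan_word => /=.
apply: tspan_mul (tspan_tin x) IH => m n /eqP-> /eqP->; exact: eqxx.
Qed.

End TensorSpan.


Section TensorComponents.
Variables (k : char2ClosedFieldType) (V : ver4Type k).
Local Notation TV := (tensor_alg V).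

(* The algebra morphism TV -> TV[X] sending x in V to x X; its n-th coefficient
   is the projection of TV onto T^n V. *)
Definition tgrade : TV -> {poly TV} :=
  tlift (polyC \o in_alg TV) (fun x => (tin x)%:P * 'X).

Definition tproj (n : nat) (a : TV) : TV := (tgrade a)`_n.

Let gC (a : k) (p : {poly TV}) :
  (polyC \o in_alg TV) a * p = p * (polyC \o in_alg TV) a.
Proof. by apply/polyP => i; rewrite /= coefCM coefMC mulr_algl mulr_algr. Qed.
Let gD : {morph (fun x : V => (tin x)%:P * 'X : {poly TV}) : x y / x + y}.
Proof. by move=> x y; rewrite raddfD /= polyCD mulrDl. Qed.
Let gZ a (x : V) :
  (tin (a *: x))%:P * 'X = (polyC \o in_alg TV) a * ((tin x)%:P * 'X).
Proof. by rewrite linearZ /= mulrA -polyCM mulr_algl. Qed.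

Lemma tproj_word n (s : seq V) :
  tproj n (\prod_(x <- s) tin x) =
    if n == size s then \prod_(x <- s) tin x else 0.
Proof.
suff E : tgrade (\prod_(x <- s) tin x) = (\prod_(x <- s) tin x)%:P * 'X^(size s).
  by rewrite /tproj E coefCM coefXn; case: eqP => _; rewrite ?mulr1 ?mulr0.
elim: s => [|x s IH] /=.
  by rewrite !big_nil expr0 mulr1; exact: (tlift1 gC gD gZ).
rewrite !big_cons {1}/tgrade (tliftM gC gD gZ) (tlift_tin gC gD gZ).
rewrite -/tgrade IH polyCM exprS -!mulrA; congr (_ * _).
by rewrite !mulrA; congr (_ * _); rewrite commr_polyX.
Qed.

Lemma tproj0 n : tproj n 0 = 0.
Proof. by rewrite /tproj /tgrade (tlift0 gC gD gZ) coef0. Qed.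
Lemma tprojD n : {morph tproj n : a b / a + b}.
Proof. by move=> a b; rewrite /tproj /tgrade (tliftD gC gD gZ) coefD. Qed.
Lemma tprojZ n c a : tproj n (c *: a) = c *: tproj n a.
Proof. by rewrite /tproj /tgrade (tliftZ gC gD gZ) /= coefCM mulr_algl. Qed.

Lemma tproj_is_linear n : linear (tproj n).
Proof. by move=> c a b; rewrite tprojD tprojZ. Qed.

HB.instance Definition _ n :=
  GRing.isLinear.Build k TV TV *:%R (tproj n) (tproj_is_linear n).

Lemma tproj_span n a : tspan (pred1 n) (tproj n a).
Proof.
elim: (tspan_predT a) => {a} [s _||a b _ Ha _ Hb|c a _ Ha].
- rewrite tproj_word; case: eqP => [->|_]; last exact: tspan0.
  by apply: tspan_word => /=.
- by rewrite raddf0; apply: tspan0.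
- by rewrite raddfD; apply: tspanD.
- by rewrite linearZ; apply: tspanZ.
Qed.

Lemma tproj_bounded a : exists N, forall n, (N <= n)%N -> tproj n a = 0.
Proof. by exists (size (tgrade a)) => n ?; rewrite /tproj nth_default. Qed.

Lemma tproj_hom m n b : tspan (pred1 m) b -> tproj n b = if n == m then b else 0.
Proof.
elim=> {b} [w /eqP <-||b b' _ Hb _ Hb'|c b _ Hb].
- exact: tproj_word.
- by rewrite raddf0 if_same.
- by rewrite raddfD /= Hb Hb'; case: ifP; rewrite ?addr0.
- by rewrite linearZ /= Hb; case: ifP; rewrite ?scaler0.
Qed.

Lemma tproj_vd n a : tproj n (vd a) = vd (tproj n a).
Proof.
elim: (tspan_predT a) => {a} [s _||a b _ Ha _ Hb|c a _ Ha]; last 3 first.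
- by rewrite !raddf0.
- by rewrite !raddfD /= Ha Hb.
- by rewrite !linearZ /= Ha.
rewrite tproj_word (@tproj_hom (size s)); first by case: ifP; rewrite ?raddf0.
by apply/tspan_vd/tspan_word => /=.
Qed.

End TensorComponents.


Inductive ideal_gen (k : char2ClosedFieldType) (A : ver4AlgType k)
    (R : A -> Prop) : A -> Prop :=
| ig_in r : R r -> ideal_gen R r
| ig0 : ideal_gen R 0
| igD a b : ideal_gen R a -> ideal_gen R b -> ideal_gen R (a + b)
| ig_mull a x : ideal_gen R x -> ideal_gen R (a * x)
| ig_mulr a x : ideal_gen R x -> ideal_gen R (x * a).

(* Quotients TV/(im r) for a morphism r : V (x) V -> TV, given on pure tensors.
   The last hypothesis makes the ideal proper: it lies in the augmentation
   ideal of TV. *)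
Section QuadraticQuotient.
Variables (k : char2ClosedFieldType) (V : ver4Type k).

Definition taug : tensor_alg V -> k := tlift idfun (fun=> 0).

Let idC (a r : k) : idfun a * r = r * idfun a. Proof. exact: mulrC. Qed.
Let f0D : {morph (fun _ : V => 0 : k) : x y / x + y}.
Proof. by move=> x y; rewrite addr0. Qed.
Let f0Z a x : (fun _ : V => 0 : k) (a *: x) = idfun a * 0.
Proof. by rewrite mulr0. Qed.

Lemma taug_tin x : taug (tin x) = 0.
Proof. exact: (tlift_tin idC f0D f0Z). Qed.
Lemma taug0 : taug 0 = 0.
Proof. exact: (tlift0 idC f0D f0Z). Qed.
Lemma taug1 : taug 1 = 1.
Proof. exact: (tlift1 idC f0D f0Z). Qed.
Lemma taugD : {morph taug : a b / a + b}.
Proof. exact: (tliftD idC f0D f0Z). Qed.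
Lemma taugM : {morph taug : a b / a * b}.
Proof. exact: (tliftM idC f0D f0Z). Qed.
Lemma taugN a : taug (- a) = - taug a.
Proof. by apply: (addrI (taug a)); rewrite -taugD !subrr taug0. Qed.

Variable r : V -> V -> tensor_alg V.
Hypothesis r_vd : forall x y, vd (r x y) = r (vd x) y + r x (vd y).
Hypothesis r_aug : forall x y, taug (r x y) = 0.

Definition rel_im (a : tensor_alg V) := exists x y, a = r x y.

Definition rel_so : subobj (tensor_alg V).
Proof.
exists (ideal_gen rel_im) => [|a b|c a|a].
- exact: ig0.
- exact: igD.
- by rewrite -[c *: a]mul1r -scalerAr scalerAl; apply: ig_mull.
- elim=> {a} [_ [x [y ->]]||a b _ Ha _ Hb|a x Ix Hx|a x Ix Hx].
  + by rewrite r_vd; apply: igD; apply: ig_in; do 2 eexists.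
  + by rewrite raddf0; apply: ig0.
  + by rewrite raddfD; apply: igD.
  + rewrite vdM; apply: igD; exact: ig_mull.
  + by rewrite vdM; apply: igD; apply: ig_mulr.
Defined.

Definition rel_ideal : dideal (tensor_alg V).
Proof.
exists rel_so => [a x|a x|]; [exact: ig_mull | exact: ig_mulr |].
suff aug0 a : rel_so a -> taug a = 0.
  by move=> /aug0 /eqP; rewrite taug1 oner_eq0.
elim=> {a} [_ [x [y ->]]||a b _ Ha _ Hb|a x _ Hx|a x _ Hx] //.
- exact: taug0.
- by rewrite taugD Ha Hb addr0.
- by rewrite taugM Hx mulr0.
- by rewrite taugM Hx mul0r.
Defined.

End QuadraticQuotient.

Section SymmetricAlgebra.
Variables (k : char2ClosedFieldType) (V : ver4Type k).

(* (c - id)(x (x) y) *)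
Definition sym_rel (x y : V) : tensor_alg V :=
  mulc (tin x) (tin y) - tin x * tin y.

Lemma sym_rel_vd x y : vd (sym_rel x y) = sym_rel (vd x) y + sym_rel x (vd y).
Proof.
rewrite /sym_rel /mulc !raddfB !raddfD /= !vdM !vd_tin !vdd !raddf0.
rewrite !(mul0r, mulr0, addr0, opprD).
by rewrite !addrA (ACl (2*3*1*4)).
Qed.

Lemma sym_rel_aug x y : taug (sym_rel x y) = 0.
Proof.
rewrite /sym_rel /mulc !vd_tin !(taugD, taugN, taugM, taug_tin).
by rewrite !mul0r oppr0 !addr0.
Qed.

Definition sym_alg := alg_quot (rel_ideal sym_rel_vd sym_rel_aug).

HB.instance Definition _ := Ver4Alg.on sym_alg.

Definition sym_pi : tensor_alg V -> sym_alg := aqpi _.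

End SymmetricAlgebra.

Section EnvelopingAlgebra.
Variables (k : char2ClosedFieldType) (L : olieType k).

(* (id - c - beta)(x (x) y) *)
Definition env_rel (x y : L) : tensor_alg L :=
  tin x * tin y - mulc (tin x) (tin y) - tin (lb x y).

Lemma env_rel_vd x y : vd (env_rel x y) = env_rel (vd x) y + env_rel x (vd y).
Proof.
rewrite /env_rel /mulc !raddfB !raddfD /= !vdM !vd_tin vd_lb !vdd !raddf0 !raddfD.
rewrite !(mul0r, mulr0, addr0, opprD, addrA).
by rewrite /= !oppr0 !addr0 (ACl (1*4*5*2*3*6)).
Qed.

Lemma env_rel_aug x y : taug (env_rel x y) = 0.
Proof.
rewrite /env_rel /mulc !vd_tin !(taugD, taugN, taugM, taug_tin).
by rewrite !mul0r ?oppr0 !addr0 oppr0 ?addr0.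
Qed.

Definition env_alg := alg_quot (rel_ideal env_rel_vd env_rel_aug).

HB.instance Definition _ := Ver4Alg.on env_alg.

Definition env_pi : tensor_alg L -> env_alg := aqpi _.

HB.instance Definition _ := GRing.RMorphism.copy env_pi (aqpi _).
HB.instance Definition _ := GRing.Linear.copy env_pi (aqpi _).

Definition env_fil (P : pred nat) : subobj env_alg.
Proof.
exists (fun u => exists2 a, tspan P a & u = env_pi a).
- by exists 0; [exact: tspan0 | rewrite raddf0].
- move=> _ _ [a Pa ->] [b Pb ->]; exists (a + b); first exact: tspanD.
  by rewrite raddfD.
- move=> c _ [a Pa ->]; exists (c *: a); first exact: tspanZ.
  by rewrite linearZ.
- move=> _ [a Pa ->]; exists (vd a); first exact: tspan_vd.
  exact: vd_aqpi.
Defined.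

(* U_n / U_(n-1), with U_(-1) = 0 *)
Definition env_gr (n : nat) : ver4Type k :=
  quot_of (so_restrict (env_fil [pred m | (m <= n)%N]) (env_fil [pred m | (m < n)%N])).

End EnvelopingAlgebra.

Section DirectSum.
Variables (k : char2ClosedFieldType) (M : nat -> ver4Type k).

Definition dsum :=
  {f : forall n, M n | exists N, forall n, (N <= n)%N -> f n = 0}.

HB.instance Definition _ := gen_eqMixin dsum.
HB.instance Definition _ := gen_choiceMixin dsum.

Lemma dsumP (f g : dsum) : (forall n, sval f n = sval g n) -> f = g.
Proof.
case: f g => [f fP] [g gP] /= fg; apply: eq_exist.
exact: functional_extensionality_dep.
Qed.

Definition dsum0 : dsum.
Proof. by exists (fun=> 0), 0%N. Defined.

Definition dsum_add (f g : dsum) : dsum.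
Proof.
exists (fun n => sval f n + sval g n).
case: f g => [f [N fN]] [g [N' gN]]; exists (maxn N N') => n /=.
by rewrite geq_max => /andP[Nn N'n]; rewrite fN ?gN ?addr0.
Defined.

Definition dsum_scale (c : k) (f : dsum) : dsum.
Proof.
exists (fun n => c *: sval f n).
by case: f => [f [N fN]]; exists N => n Nn /=; rewrite fN ?scaler0.
Defined.

Definition dsum_vd (f : dsum) : dsum.
Proof.
exists (fun n => vd (sval f n)).
by case: f => [f [N fN]]; exists N => n Nn /=; rewrite fN ?raddf0.
Defined.

Lemma dsum_addA : associative dsum_add.
Proof. by move=> f g h; apply: dsumP => n /=; rewrite addrA. Qed.
Lemma dsum_addC : commutative dsum_add.
Proof. by move=> f g; apply: dsumP => n /=; rewrite addrC. Qed.
Lemma dsum_add0 : left_id dsum0 dsum_add.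
Proof. by move=> f; apply: dsumP => n /=; rewrite add0r. Qed.
Lemma dsum_addN : left_inverse dsum0 (dsum_scale (-1)) dsum_add.
Proof. by move=> f; apply: dsumP => n /=; rewrite scaleN1r addNr. Qed.

HB.instance Definition _ := GRing.isZmodule.Build dsum
  dsum_addA dsum_addC dsum_add0 dsum_addN.

Lemma dsum_scaleA (a b : k) f : dsum_scale a (dsum_scale b f) = dsum_scale (a * b) f.
Proof. by apply: dsumP => n /=; rewrite scalerA. Qed.
Lemma dsum_scale1 : left_id 1 dsum_scale.
Proof. by move=> f; apply: dsumP => n /=; rewrite scale1r. Qed.
Lemma dsum_scaleDr : right_distributive dsum_scale +%R.
Proof. by move=> a f g; apply: dsumP => n /=; rewrite scalerDr. Qed.
Lemma dsum_scaleDl f : {morph dsum_scale^~ f : a b / a + b}.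
Proof. by move=> a b; apply: dsumP => n /=; rewrite scalerDl. Qed.

HB.instance Definition _ := GRing.Zmodule_isLmodule.Build k dsum
  dsum_scaleA dsum_scale1 dsum_scaleDr dsum_scaleDl.

Lemma dsum_vd_linear : linear dsum_vd.
Proof. by move=> a f g; apply: dsumP => n /=; rewrite linearP. Qed.
Lemma dsum_vdd f : dsum_vd (dsum_vd f) = 0.
Proof. by apply: dsumP => n /=; rewrite vdd. Qed.

HB.instance Definition _ := isVer4.Build k dsum dsum_vd_linear dsum_vdd.

End DirectSum.

Section PBW.
Variables (k : char2ClosedFieldType) (L : olieType k).
Local Notation TL := (tensor_alg L).

Lemma env_fil_proj n (a : TL) : env_fil L [pred m | (m <= n)%N] (env_pi (tproj n a)).
Proof.
exists (tproj n a) => //.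
by apply: tspan_sub (tproj_span n a) => m /eqP->; apply: leqnn.
Qed.

Definition eta_comp n (a : TL) : env_gr L n :=
  qpi (so_restrict _ _) (sub_mk (env_fil_proj n a)).

Lemma eta_comp0P n a :
  eta_comp n a = 0 <-> env_fil L [pred m | (m < n)%N] (env_pi (tproj n a)).
Proof. exact: qpi0P. Qed.

Lemma eta_comp_linear n : linear (eta_comp n).
Proof.
move=> c a b; rewrite /eta_comp -linearP; congr (qpi _ _).
by apply: val_inj; rewrite /= !linearP.
Qed.

Lemma eta_bounded a : exists N, forall n, (N <= n)%N -> eta_comp n a = 0.
Proof.
have [N HN] := tproj_bounded a; exists N => n /HN E.
by apply/eta_comp0P; rewrite E raddf0; apply: so0.
Qed.

(* TL -> gr U(L), sending a in T^n L to its class in U_n / U_(n-1) *)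
Definition eta_tensor (a : TL) : dsum (env_gr L) :=
  exist _ (fun n => eta_comp n a) (eta_bounded a).

Lemma eta_tensor_linear : linear eta_tensor.
Proof. by move=> c a b; apply: dsumP => n; exact: eta_comp_linear. Qed.

HB.instance Definition _ :=
  GRing.isLinear.Build k TL (dsum (env_gr L)) *:%R eta_tensor eta_tensor_linear.

Lemma env_pi_rel (x y : L) : env_pi (env_rel x y) = 0.
Proof. by apply/qpi0P/ig_in; exists x, y. Qed.

Lemma env_pi_sym_rel (x y : L) : env_pi (sym_rel x y) = env_pi (- tin (lb x y)).
Proof.
apply/subr0_eq; rewrite -raddfB opprK /= -[RHS]oppr0 -(env_pi_rel x y) -raddfN.
by congr (env_pi _); rewrite /env_rel /sym_rel !opprD !opprK (addrC (- _)).
Qed.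

Lemma sym_rel_span (x y : L) : tspan (pred1 2%N) (sym_rel x y).
Proof.
have H (u v : L) : tspan (pred1 2%N) (tin u * tin v).
  by apply: tspan_mul (tspan_tin u) (tspan_tin v) => m n /eqP-> /eqP->.
rewrite /sym_rel /mulc !vd_tin -scaleN1r.
by do !apply: tspanD => //; apply: tspanZ.
Qed.

Lemma eta_tensor_rel b (x y : L) c : eta_tensor (b * sym_rel x y * c) = 0.
Proof.
elim: (tspan_predT b) => {b} [s _||b b' _ Hb _ Hb'|a b _ Hb]; last 3 first.
- by rewrite !mul0r raddf0.
- by rewrite !mulrDl raddfD /= Hb Hb' addr0.
- by rewrite -!scalerAl linearZ /= Hb scaler0.
elim: (tspan_predT c) => {c} [s' _||c c' _ Hc _ Hc'|a c _ Hc]; last 3 first.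
- by rewrite !mulr0 raddf0.
- by rewrite mulrDr raddfD /= Hc Hc' addr0.
- by rewrite -!scalerAr linearZ /= Hc scaler0.
apply: dsumP => n; apply/eta_comp0P.
set w := \prod_(z <- s) _; set w' := \prod_(z <- s') _.
rewrite (@tproj_hom _ _ (size s + 2 + size s')%N); last first.
  apply: (@tspan_mul _ _ (pred1 (size s + 2)%N) (pred1 (size s'))).
  - by move=> p q /eqP-> /eqP->; exact: eqxx.
  - apply: (@tspan_mul _ _ (pred1 (size s)) (pred1 2%N)).
    + by move=> p q /eqP-> /eqP->; exact: eqxx.
    + by apply: tspan_word => /=.
    + exact: sym_rel_span.
  - by apply: tspan_word => /=.
case: eqP => [->|_]; last by rewrite raddf0; apply: so0.
exists (w * (- tin (lb x y)) * w').
  apply: (@tspan_mul _ _ (pred1 (size s + 1)%N) (pred1 (size s'))).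
  - move=> p q /eqP-> /eqP->; rewrite /= -!addnA ltn_add2l.
    exact: ltnSn.
  - apply: (@tspan_mul _ _ (pred1 (size s)) (pred1 1%N)).
    + by move=> p q /eqP-> /eqP->; exact: eqxx.
    + by apply: tspan_word => /=.
    + by rewrite -scaleN1r; apply/tspanZ/tspan_tin.
  - by apply: tspan_word => /=.
by rewrite rmorphM /= [env_pi (w * _)]rmorphM /= env_pi_sym_rel -!rmorphM.
Qed.

Lemma eta_tensor_ideal a : rel_so (@sym_rel_vd k L) a -> eta_tensor a = 0.
Proof.
suff H : rel_so (@sym_rel_vd k L) a -> forall b c, eta_tensor (b * a * c) = 0.
  by move=> /H /(_ 1 1); rewrite mul1r mulr1.
elim=> {a} [_ [x [y ->]]||a a' _ Ha _ Ha'|a x _ Hx|a x _ Hx] b c.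
- exact: eta_tensor_rel.
- by rewrite mulr0 mul0r raddf0.
- by rewrite mulrDr mulrDl raddfD /= Ha Ha' addr0.
- by rewrite !mulrA Hx.
- by rewrite !mulrA -[_ * a * c]mulrA Hx.
Qed.

(* The map Sym L -> gr U(L) induced by eta_tensor, see eta_sym_pi. *)
Definition eta (q : sym_alg L) : dsum (env_gr L) := eta_tensor (repr q).

Lemma eta_sym_pi a : eta (sym_pi a) = eta_tensor a.
Proof.
apply/subr0_eq; rewrite -raddfB; apply: eta_tensor_ideal.
by apply/(@qpi_eqP k TL (rel_so (@sym_rel_vd k L))); rewrite /qpi reprK.
Qed.

Lemma eta_linear : linear eta.
Proof.
move=> c p q; have [a ->] := aqpi_surj p; have [b ->] := aqpi_surj q.
by rewrite -linearP !eta_sym_pi linearP.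
Qed.

HB.instance Definition _ :=
  GRing.isLinear.Build k (sym_alg L) (dsum (env_gr L)) *:%R eta eta_linear.

Lemma eta_vd q : eta (vd q) = vd (eta q).
Proof.
have [a ->] := aqpi_surj q; rewrite vd_aqpi !eta_sym_pi.
apply: dsumP => n; rewrite /= /eta_comp vd_qpi; congr (qpi _ _).
by apply: val_inj; rewrite /= tproj_vd; exact/esym/vd_aqpi.
Qed.

(* Isomorphisms of ind-objects are the bijective morphisms; see also
   eta_linear and eta_vd. *)
Definition satisfies_PBW : Prop := bijective eta.

End PBW.

(* Noncommutative polynomials over F_2 as lists of words, used to check the
   Jacobi identity of the braided commutator by computation. *)
Section Words.
Variables (k : char2ClosedFieldType) (A : algType k) (e : nat -> A).

Definition wev (p : seq (seq nat)) : A := \sum_(w <- p) \prod_(i <- w) e i.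
Definition wmul (p q : seq (seq nat)) := [seq u ++ v | u <- p, v <- q].

Lemma wev_var i : wev [:: [:: i]] = e i.
Proof. by rewrite /wev !big_seq1. Qed.

Lemma wevD p q : wev (p ++ q) = wev p + wev q.
Proof. by rewrite /wev big_cat. Qed.

Lemma wevM p q : wev (wmul p q) = wev p * wev q.
Proof.
rewrite /wev /wmul big_allpairs_dep mulr_suml; apply: eq_bigr => u _.
by rewrite mulr_sumr; apply: eq_bigr => v _; rewrite big_cat.
Qed.

Lemma wev_even p : all (fun w => ~~ odd (count_mem w p)) p -> wev p = 0.
Proof.
move=> /allP pe; rewrite /wev -big_undup_iterop_count big_seq big1 // => w.
rewrite mem_undup => /pe; rewrite -[iterop _ _ _ _]/(_ *+ count_mem w p).
move=> ev; rewrite -[count_mem w p]odd_double_half (negbTE ev) add0n.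
by rewrite -muln2 mulrnA mulr2n addvv.
Qed.

End Words.

Section Commutator.
Variables (k : char2ClosedFieldType) (A : ver4AlgType k).

(* A as an operadic Lie algebra: the bracket is m o (id - c) *)
Definition comm_lie : Type := A.

HB.instance Definition _ := Ver4.on comm_lie.

Definition comm_lb (a b : comm_lie) : comm_lie := (a : A) * b - mulc (a : A) b.

Let bra (x x' y y' : A) := x * y + y * x + y' * x'.

Lemma comm_lbE a b : comm_lb a b = bra a (vd a) b (vd b).
Proof. by rewrite /comm_lb /mulc oppv /bra addrA. Qed.

Lemma comm_linearl b : linear (comm_lb^~ b).
Proof.
move=> c a a'; rewrite !comm_lbE /bra !linearP !(mulrDl, mulrDr) !scalerDr.
rewrite -!(scalerAl, scalerAr) !addrA.
by rewrite (ACl (1*3*5*2*4*6)).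
Qed.

Lemma comm_linearr a : linear (comm_lb a).
Proof.
move=> c b b'; rewrite !comm_lbE /bra !linearP !(mulrDl, mulrDr) !scalerDr.
rewrite -!(scalerAl, scalerAr) !addrA.
by rewrite (ACl (1*3*5*2*4*6)).
Qed.

Lemma comm_vd a b : vd (comm_lb a b) = comm_lb (vd a) b + comm_lb a (vd b).
Proof.
rewrite !comm_lbE /bra !raddfD /= !vdM !vdd !(mul0r, mulr0, addr0) !addrA.
by rewrite (ACl (1*4*2*3)).
Qed.

Lemma comm_anti a b : comm_lb a b + comm_lb b a + comm_lb (vd b) (vd a) = 0.
Proof.
rewrite !comm_lbE /bra !vdd mul0r addr0.
rewrite -(@wev_even k A (nth 0 [:: a; b; vd a; vd b])
  [:: [:: 0; 1]; [:: 1; 0]; [:: 3; 2]; [:: 1; 0]; [:: 0; 1]; [:: 2; 3];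
      [:: 3; 2]; [:: 2; 3]]%N) //.
by rewrite /wev !big_cons !big_nil /= !mulr1 !addr0 !addrA.
Qed.

Let wbr (x x' y y' : seq (seq nat)) := wmul x y ++ wmul y x ++ wmul y' x'.

Let wev_br e x x' y y' :
  wev e (wbr x x' y y') = bra (wev e x) (wev e x') (wev e y) (wev e y').
Proof. by rewrite /wbr !wevD !wevM addrA. Qed.

Lemma comm_jacobi x y z :
  comm_lb (comm_lb x y) z + comm_lb (comm_lb z x) y + comm_lb (comm_lb y z) x
  + comm_lb (comm_lb (vd x) y) (vd z) + comm_lb (comm_lb (vd z) x) (vd y)
  + comm_lb (comm_lb (vd y) z) (vd x) = 0.
Proof.
have vd_bra (a b : A) :
  vd (bra a (vd a) b (vd b)) = bra (vd a) 0 b (vd b) + bra a (vd a) (vd b) 0.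
  by have := comm_vd a b; rewrite !comm_lbE !vdd.
rewrite !comm_lbE !vd_bra !vdd.
pose e := nth 0 [:: x : A; y : A; z : A; vd x; vd y; vd z].
have [ex ey ez] : [/\ x = wev e [:: [:: 0]], y = wev e [:: [:: 1]] &
  z = wev e [:: [:: 2]]]%N by rewrite !wev_var.
have [edx edy edz] : [/\ vd x = wev e [:: [:: 3]], vd y = wev e [:: [:: 4]] &
  vd z = wev e [:: [:: 5]]]%N by rewrite !wev_var.
have e0 : 0 = wev e [::] by rewrite /wev big_nil.
move: e ex ey ez edx edy edz e0 => e.
move: (vd x) (vd y) (vd z) => x' y' z' -> -> -> -> -> -> e0.
rewrite e0 -!(wev_br, wevD) -e0; apply: wev_even; vm_compute; reflexivity.
Qed.

HB.instance Definition _ := isOLie.Build k comm_lie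
  comm_linearl comm_linearr comm_vd comm_anti comm_jacobi.

End Commutator.

(* The free operadic Lie algebra FOLie(V): formal expressions modulo the
   smallest d-stable congruence that forces the axioms of operadic Lie algebras
   and the linearity of the generators. *)
Inductive lterm (k : char2ClosedFieldType) (V : ver4Type k) : Type :=
| lgen of V
| lzero
| ladd of lterm V & lterm V
| lscale of k & lterm V
| lbr of lterm V & lterm V.

Arguments lzero {k V}.

HB.instance Definition _ k (V : ver4Type k) := gen_eqMixin (lterm V).
HB.instance Definition _ k (V : ver4Type k) := gen_choiceMixin (lterm V).

Fixpoint ldiff (k : char2ClosedFieldType) (V : ver4Type k) (t : lterm V) :
    lterm V :=
  match t with
  | lgen x => lgen (vd x)
  | lzero => lzero
  | ladd t u => ladd (ldiff t) (ldiff u)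
  | lscale a t => lscale a (ldiff t)
  | lbr t u => ladd (lbr (ldiff t) u) (lbr t (ldiff u))
  end.

Inductive lcong (k : char2ClosedFieldType) (V : ver4Type k) :
    lterm V -> lterm V -> Prop :=
| lc_refl t : lcong t t
| lc_sym t u : lcong t u -> lcong u t
| lc_trans t u v : lcong t u -> lcong u v -> lcong t v
| lc_add t t' u u' : lcong t t' -> lcong u u' -> lcong (ladd t u) (ladd t' u')
| lc_scale a t t' : lcong t t' -> lcong (lscale a t) (lscale a t')
| lc_br t t' u u' : lcong t t' -> lcong u u' -> lcong (lbr t u) (lbr t' u')
| lc_vd t t' : lcong t t' -> lcong (ldiff t) (ldiff t')
| lc_addA t u v : lcong (ladd t (ladd u v)) (ladd (ladd t u) v)
| lc_addC t u : lcong (ladd t u) (ladd u t)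
| lc_add0 t : lcong (ladd lzero t) t
| lc_scale0 t : lcong (lscale 0 t) lzero
| lc_scale1 t : lcong (lscale 1 t) t
| lc_scaleA a b t : lcong (lscale a (lscale b t)) (lscale (a * b) t)
| lc_scaleDr a t u : lcong (lscale a (ladd t u)) (ladd (lscale a t) (lscale a u))
| lc_scaleDl a b t : lcong (lscale (a + b) t) (ladd (lscale a t) (lscale b t))
| lc_brDl t u v : lcong (lbr (ladd t u) v) (ladd (lbr t v) (lbr u v))
| lc_brDr t u v : lcong (lbr t (ladd u v)) (ladd (lbr t u) (lbr t v))
| lc_brZl a t u : lcong (lbr (lscale a t) u) (lscale a (lbr t u))
| lc_brZr a t u : lcong (lbr t (lscale a u)) (lscale a (lbr t u))
| lc_anti t u :
    lcong (ladd (ladd (lbr t u) (lbr u t)) (lbr (ldiff u) (ldiff t))) lzero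
| lc_jacobi t u v :
    lcong (ladd (ladd (ladd (ladd (ladd
      (lbr (lbr t u) v) (lbr (lbr v t) u)) (lbr (lbr u v) t))
      (lbr (lbr (ldiff t) u) (ldiff v))) (lbr (lbr (ldiff v) t) (ldiff u)))
      (lbr (lbr (ldiff u) v) (ldiff t))) lzero
| lc_genD x y : lcong (lgen (x + y)) (ladd (lgen x) (lgen y))
| lc_genZ a x : lcong (lgen (a *: x)) (lscale a (lgen x)).

Section FreeOLie.
Variables (k : char2ClosedFieldType) (V : ver4Type k).

Definition leqv (t u : lterm V) : bool := `[< lcong t u >].

Lemma leqv_equiv : equiv_class_of leqv.
Proof.
split=> [t|t u|u t v].
- exact/asboolP/lc_refl.
- by apply/asboolP/asboolP; apply: lc_sym.
- by move=> /asboolP tu /asboolP uv; apply/asboolP; apply: lc_trans tu uv.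
Qed.

Canonical leqv_rel := EquivRelPack leqv_equiv.

Definition free_olie := {eq_quot leqv_rel}.

HB.instance Definition _ := Choice.on free_olie.

Definition lcl (t : lterm V) : free_olie := \pi_{eq_quot leqv_rel} t.

Lemma lcl_eqP t u : lcl t = lcl u <-> lcong t u.
Proof. by split=> [/eqmodP/asboolP|/asboolP tu] //; apply/eqmodP. Qed.

Lemma lcl_surj (a : free_olie) : exists t, a = lcl t.
Proof. by exists (repr a); rewrite /lcl reprK. Qed.

Lemma lcl_repr t : lcong (repr (lcl t)) t.
Proof. by apply/lcl_eqP; rewrite /lcl reprK. Qed.

Definition fl_add (a b : free_olie) := lcl (ladd (repr a) (repr b)).
Definition fl_scale c (a : free_olie) := lcl (lscale c (repr a)).
Definition fl_lb (a b : free_olie) := lcl (lbr (repr a) (repr b)).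
Definition fl_vd (a : free_olie) := lcl (ldiff (repr a)).
Definition fl_opp := fl_scale (-1).

Lemma lclD t u : fl_add (lcl t) (lcl u) = lcl (ladd t u).
Proof. by apply/lcl_eqP/lc_add; apply: lcl_repr. Qed.
Lemma lclZ c t : fl_scale c (lcl t) = lcl (lscale c t).
Proof. by apply/lcl_eqP/lc_scale; apply: lcl_repr. Qed.
Lemma lclB t u : fl_lb (lcl t) (lcl u) = lcl (lbr t u).
Proof. by apply/lcl_eqP/lc_br; apply: lcl_repr. Qed.
Lemma lcl_vd t : fl_vd (lcl t) = lcl (ldiff t).
Proof. by apply/lcl_eqP/lc_vd; apply: lcl_repr. Qed.

Ltac llift := repeat (let a := fresh in let t := fresh in
    move=> a; case: (lcl_surj a) => t ->);
  rewrite ?(lclD, lclZ, lclB, lcl_vd).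

Lemma fl_addA : associative fl_add.
Proof. by llift; apply/lcl_eqP/lc_addA. Qed.
Lemma fl_addC : commutative fl_add.
Proof. by llift; apply/lcl_eqP/lc_addC. Qed.
Lemma fl_add0 : left_id (lcl lzero) fl_add.
Proof. by llift; apply/lcl_eqP/lc_add0. Qed.
Lemma fl_addN : left_inverse (lcl lzero) fl_opp fl_add.
Proof.
move=> a; case: (lcl_surj a) => t ->; rewrite /fl_opp lclZ lclD.
apply/lcl_eqP; apply: lc_trans (lc_scale0 t).
rewrite -(addNr 1); apply: lc_trans (lc_sym (lc_scaleDl _ _ _)).
by apply: lc_add; [apply: lc_refl | apply/lc_sym/lc_scale1].
Qed.

HB.instance Definition _ := GRing.isZmodule.Build free_olie
  fl_addA fl_addC fl_add0 fl_addN.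

Lemma fl_scaleA a b v : fl_scale a (fl_scale b v) = fl_scale (a * b) v.
Proof. by move: v; llift; apply/lcl_eqP/lc_scaleA. Qed.
Lemma fl_scale1 : left_id 1 fl_scale.
Proof. by llift; apply/lcl_eqP/lc_scale1. Qed.
Lemma fl_scaleDr : right_distributive fl_scale fl_add.
Proof. by move=> a; llift; apply/lcl_eqP/lc_scaleDr. Qed.
Lemma fl_scaleDl v : {morph fl_scale^~ v : a b / a + b >-> fl_add a b}.
Proof. by move=> a b; move: v; llift; apply/lcl_eqP/lc_scaleDl. Qed.

HB.instance Definition _ := GRing.Zmodule_isLmodule.Build k free_olie
  fl_scaleA fl_scale1 fl_scaleDr fl_scaleDl.

Lemma lcl0 : lcl lzero = 0. Proof. by []. Qed.
Lemma lcl_add t u : lcl (ladd t u) = lcl t + lcl u.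
Proof. by rewrite -lclD. Qed.
Lemma lcl_scale a t : lcl (lscale a t) = a *: lcl t.
Proof. by rewrite -lclZ. Qed.
Lemma lcl_br t u : lcl (lbr t u) = fl_lb (lcl t) (lcl u).
Proof. by rewrite -lclB. Qed.

Lemma fl_vd_linear : linear fl_vd.
Proof.
move=> c a b; case: (lcl_surj a) => t ->; case: (lcl_surj b) => u ->.
by rewrite -lcl_scale -lcl_add !lcl_vd /= lcl_add lcl_scale.
Qed.

Lemma fl_linearl b : linear (fl_lb^~ b).
Proof.
move=> c a a'; case: (lcl_surj a) => t ->; case: (lcl_surj a') => t' ->.
case: (lcl_surj b) => u ->.
rewrite -[LHS]/(fl_lb (c *: lcl t + lcl t') (lcl u)).
rewrite -[RHS]/(c *: fl_lb (lcl t) (lcl u) + fl_lb (lcl t') (lcl u)).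
rewrite -[fl_lb (lcl t) _]lcl_br -[fl_lb (lcl t') _]lcl_br -!lcl_scale -!lcl_add -lcl_br; apply/lcl_eqP.
apply: lc_trans (lc_brDl _ _ _) _.
by apply: lc_add; [apply: lc_brZl | apply: lc_refl].
Qed.

Lemma fl_linearr b : linear (fl_lb b).
Proof.
move=> c a a'; case: (lcl_surj a) => t ->; case: (lcl_surj a') => t' ->.
case: (lcl_surj b) => u ->.
rewrite -[fl_lb _ (lcl t)]lcl_br -[fl_lb _ (lcl t')]lcl_br.
rewrite -!lcl_scale -!lcl_add -lcl_br; apply/lcl_eqP.
apply: lc_trans (lc_brDr _ _ _) _.
by apply: lc_add; [apply: lc_brZr | apply: lc_refl].
Qed.

Lemma fl_vd_lb a b : fl_vd (fl_lb a b) = fl_lb (fl_vd a) b + fl_lb a (fl_vd b).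
Proof.
case: (lcl_surj a) => t ->; case: (lcl_surj b) => u ->.
by rewrite -lcl_br !lcl_vd -!lcl_br -lcl_add.
Qed.

Definition lin (x : V) : free_olie := lcl (lgen x).

Lemma fl_vd_lin x : fl_vd (lin x) = lin (vd x).
Proof. exact: lcl_vd. Qed.

Lemma free_olie_ind0 (P : free_olie -> Prop) :
  (forall x, P (lin x)) -> P 0 ->
  (forall a b, P a -> P b -> P (a + b)) -> (forall c a, P a -> P (c *: a)) ->
  (forall a b, P a -> P b -> P (fl_lb a b)) -> forall a, P a.
Proof.
move=> Pg P0 PD PZ PB a; case: (lcl_surj a) => t -> {a}.
elim: t => [x||t Pt u Pu|c t Pt|t Pt u Pu].
- exact: Pg.
- exact: P0.
- by rewrite lcl_add; apply: PD.
- by rewrite lcl_scale; apply: PZ.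
- by rewrite lcl_br; apply: PB.
Qed.

Lemma lin_is_linear : linear lin.
Proof.
move=> a x y; rewrite /lin -lcl_scale -lcl_add; apply/lcl_eqP.
apply: lc_trans (lc_genD _ _) _.
by apply: lc_add; [apply: lc_genZ | apply: lc_refl].
Qed.

HB.instance Definition _ := GRing.isLinear.Build k V free_olie *:%R lin lin_is_linear.

Lemma fl_vdd a : fl_vd (fl_vd a) = 0.
Proof.
have dD x y : fl_vd (x + y) = fl_vd x + fl_vd y.
  by have := fl_vd_linear 1 x y; rewrite !scale1r.
have d0 : fl_vd 0 = 0 by apply: (addrI (fl_vd 0)); rewrite -dD !addr0.
have dZ c x : fl_vd (c *: x) = c *: fl_vd x.
  by have := fl_vd_linear c x 0; rewrite d0 !addr0.
have fl0 b : fl_lb 0 b = 0.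
  have /= := fl_linearl b 1 0 0; rewrite !scale1r !addr0 => E.
  by apply: (addrI (fl_lb 0 b)); rewrite -E addr0.
have fl0r b : fl_lb b 0 = 0.
  have /= := fl_linearr b 1 0 0; rewrite !scale1r !addr0 => E.
  by apply: (addrI (fl_lb b 0)); rewrite -E addr0.
elim/free_olie_ind0: a => [x||a b Ha Hb|c a Ha|a b Ha Hb].
- by rewrite !fl_vd_lin vdd raddf0.
- by rewrite !d0.
- by rewrite !dD Ha Hb addr0.
- by rewrite !dZ Ha scaler0.
- rewrite fl_vd_lb dD !fl_vd_lb Ha Hb fl0 fl0r add0r addr0.
  exact: addvv.
Qed.

HB.instance Definition _ := isVer4.Build k free_olie fl_vd_linear fl_vdd.

Lemma fl_anti a b : fl_lb a b + fl_lb b a + fl_lb (vd b) (vd a) = 0.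
Proof.
case: (lcl_surj a) => t ->; case: (lcl_surj b) => u ->.
rewrite -[vd (lcl t)]/(fl_vd _) -[vd (lcl u)]/(fl_vd _) !lcl_vd.
by rewrite -!(lcl_add, lcl_br); apply/lcl_eqP/lc_anti.
Qed.

Lemma fl_jacobi x y z :
  fl_lb (fl_lb x y) z + fl_lb (fl_lb z x) y + fl_lb (fl_lb y z) x
  + fl_lb (fl_lb (vd x) y) (vd z) + fl_lb (fl_lb (vd z) x) (vd y)
  + fl_lb (fl_lb (vd y) z) (vd x) = 0.
Proof.
case: (lcl_surj x) => t ->; case: (lcl_surj y) => u ->.
case: (lcl_surj z) => v ->.
have E w : vd (lcl w) = lcl (ldiff w) by exact: lcl_vd.
by rewrite !E -!(lcl_add, lcl_br); apply/lcl_eqP/lc_jacobi.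
Qed.

HB.instance Definition _ := isOLie.Build k free_olie
  fl_linearl fl_linearr fl_vd_lb fl_anti fl_jacobi.

Lemma vd_lin x : vd (lin x) = lin (vd x).
Proof. exact: fl_vd_lin. Qed.

Lemma lcl_lb t u : lcl (lbr t u) = lb (lcl t) (lcl u).
Proof. exact: lcl_br. Qed.

Lemma lcl_d t : lcl (ldiff t) = vd (lcl t).
Proof. exact/esym/lcl_vd. Qed.

Lemma free_olie_ind (P : free_olie -> Prop) :
  (forall x, P (lin x)) -> P 0 ->
  (forall a b, P a -> P b -> P (a + b)) -> (forall c a, P a -> P (c *: a)) ->
  (forall a b, P a -> P b -> P (lb a b)) -> forall a, P a.
Proof. exact: free_olie_ind0. Qed.

(* FOLie is left adjoint to the forgetful functor: existence of the induced
   morphism; its uniqueness is free_olie_ind. *)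
Section Universal.
Variables (M : olieType k) (f : {linear V -> M}).

Fixpoint leval (t : lterm V) : M :=
  match t with
  | lgen x => f x
  | lzero => 0
  | ladd t u => leval t + leval u
  | lscale a t => a *: leval t
  | lbr t u => lb (leval t) (leval u)
  end.

Definition olift (a : free_olie) : M := leval (repr a).

Hypothesis f_vd : forall x, f (vd x) = vd (f x).

Lemma leval_diff t : leval (ldiff t) = vd (leval t).
Proof.
elim: t => [x||t IHt u IHu|c t IHt|t IHt u IHu] /=.
- exact: f_vd.
- by rewrite raddf0.
- by rewrite raddfD /= IHt IHu.
- by rewrite linearZ /= IHt.
- by rewrite vd_lb IHt IHu.
Qed.

Lemma leval_cong t u : lcong t u -> leval t = leval u.
Proof.
elim=> {t u} /=.
- by [].
- by move=> t u _ ->.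
- by move=> t u v _ -> _ ->.
- by move=> t t' u u' _ -> _ ->.
- by move=> a t t' _ ->.
- by move=> t t' u u' _ -> _ ->.
- by move=> t t' _ E; rewrite !leval_diff E.
- by move=> t u v; rewrite addrA.
- by move=> t u; rewrite addrC.
- by move=> t; rewrite add0r.
- by move=> t; rewrite scale0r.
- by move=> t; rewrite scale1r.
- by move=> a b t; rewrite scalerA.
- by move=> a t u; rewrite scalerDr.
- by move=> a b t; rewrite scalerDl.
- by move=> t u v; rewrite lbDl.
- by move=> t u v; rewrite lbDr.
- by move=> a t u; rewrite lbZl.
- by move=> a t u; rewrite lbZr.
- by move=> t u; rewrite !leval_diff lb_anti.
- by move=> t u v; rewrite !leval_diff lb_jacobi.
- by move=> x y; rewrite raddfD.
- by move=> a x; rewrite linearZ.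
Qed.

Let oliftE t : olift (lcl t) = leval t.
Proof. exact/leval_cong/lcl_repr. Qed.

Lemma olift_lin x : olift (lin x) = f x.
Proof. exact: oliftE. Qed.

Lemma olift_linear : linear olift.
Proof.
move=> c a b; case: (lcl_surj a) => t ->; case: (lcl_surj b) => u ->.
by rewrite -lcl_scale -lcl_add !oliftE.
Qed.

Lemma olift_lb a b : olift (lb a b) = lb (olift a) (olift b).
Proof.
case: (lcl_surj a) => t ->; case: (lcl_surj b) => u ->.
by rewrite -lcl_lb !oliftE.
Qed.

Lemma olift_vd a : olift (vd a) = vd (olift a).
Proof. by case: (lcl_surj a) => t ->; rewrite -lcl_d !oliftE leval_diff. Qed.

End Universal.

End FreeOLie.

Arguments lin {k V} x.

(* FOLie_n(V): the span of the n-fold brackets of elements of V *)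
Inductive folie_deg (k : char2ClosedFieldType) (V : ver4Type k) :
    nat -> free_olie V -> Prop :=
| fd_lin x : folie_deg 1 (lin x)
| fd_lb m n a b : folie_deg m a -> folie_deg n b -> folie_deg (m + n) (lb a b)
| fd_0 n : folie_deg n 0
| fd_add n a b : folie_deg n a -> folie_deg n b -> folie_deg n (a + b)
| fd_scale n c a : folie_deg n a -> folie_deg n (c *: a).

Section LieCondition.
Variable k : char2ClosedFieldType.

(* phi^V : FOLie(V) -> TV, induced by the inclusion of V into TV *)
Definition lie_phi (V : ver4Type k) : free_olie V -> comm_lie (tensor_alg V) :=
  olift (tin : {linear V -> comm_lie (tensor_alg V)}).

(* beta^L : FOLie(L) -> L, induced by the identity of L *)
Definition lie_beta (L : olieType k) : free_olie L -> L :=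
  olift (idfun : {linear L -> L}).

(* E_n(V) = ker phi^V_n, as a subspace of FOLie(V) *)
Definition folie_ker (V : ver4Type k) (n : nat) (a : free_olie V) : Prop :=
  folie_deg n a /\ lie_phi a = 0.

Lemma tin_vd (V : ver4Type k) (x : V) :
  tin (vd x) = vd (tin x : comm_lie (tensor_alg V)).
Proof. by rewrite -vd_tin. Qed.

Lemma lie_phi_lin (V : ver4Type k) (x : V) : lie_phi (lin x) = tin x.
Proof. exact/olift_lin/tin_vd. Qed.

Lemma lie_phi_linear (V : ver4Type k) : linear (@lie_phi V).
Proof. exact/olift_linear/tin_vd. Qed.

Lemma lie_phi_lb (V : ver4Type k) (a b : free_olie V) :
  lie_phi (lb a b) = lb (lie_phi a) (lie_phi b).
Proof. exact/olift_lb/tin_vd. Qed.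

Lemma lie_phi_vd (V : ver4Type k) (a : free_olie V) :
  lie_phi (vd a) = vd (lie_phi a).
Proof. exact/olift_vd/tin_vd. Qed.

Lemma lie_beta_lin (L : olieType k) (x : L) : lie_beta (lin x) = x.
Proof. exact: (@olift_lin k L L idfun). Qed.

Lemma lie_beta_linear (L : olieType k) : linear (@lie_beta L).
Proof. exact: (@olift_linear k L L idfun). Qed.

Lemma lie_beta_lb (L : olieType k) (a b : free_olie L) :
  lie_beta (lb a b) = lb (lie_beta a) (lie_beta b).
Proof. exact: (@olift_lb k L L idfun). Qed.

Lemma lie_beta_vd (L : olieType k) (a : free_olie L) :
  lie_beta (vd a) = vd (lie_beta a).
Proof. exact: (@olift_vd k L L idfun). Qed.

Definition is_lie (L : olieType k) : Prop :=
  forall (n : nat) (a : free_olie L), (0 < n)%N -> folie_ker n a -> lie_beta a = 0.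

End LieCondition.

(* Main.v *)
Require Import Defs.
From mathcomp Require Import all_boot all_algebra.
From mathcomp Require Import zify boolp classical_sets wochoice.
Set Implicit Arguments.
Unset Strict Implicit.
Unset Printing Implicit Defensive.
Import GRing.Theory.
Local Open Scope ring_scope.

(** If L is a Lie algebra and dx = 0, then [x,x] is the value of an element of
    FOLie_2(L) whose image in TL is 2 x^2 + x'x' = 0, so [x,x] = 0.

    Conversely, assume [x,x] = 0 on ker d.  Everything reduces to the PBW
    theorem: if L embeds in U(L), then an element of FOLie(L) that vanishes in
    TL vanishes in U(L), where it equals its value in L (env_lie_phi).

    For PBW, let J_m be the span of the elements a r b with r a defining
    relation of U(L) and a, b tensors with deg a + deg b + 2 <= m.  The ideal
    of U(L) is the union of the J_m, and the degree m component of an element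
    of J_m lies in the ideal of Sym L (env_rels_lead).  Hence it suffices that
    an element of J_(n+1) of degree at most n already lies in J_n
    (env_rels_descend), for then every element of the ideal of degree at most
    n lies in J_n.

    This step is proved by constructing a linear map G : TL -> TL/J_n that is
    the projection on tensors of degree at most n and kills J_(n+1).  In
    degree n+1 it amounts to a multilinear F on words of length n+1 with
      F(u x y v) + F(u y x v) + F(u y' x' v) = class of u [x,y] v,
    an exchange relation (multilinear_potential).  A function satisfying it on
    all words, but not multilinear, is constructed by rewriting
    (word_potential): totally order the vectors, sort words by adjacent
    exchanges, and replace x'x' by [x,x], as the relation with x = y demands.
    This defines F, provided that the result does not depend on the order of
    the steps (confluent).  For two steps at distant places this is formal, for
    a square z'z' next to a letter x it is [[z,z],x] = [[z',x],z'], for three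
    equal letters it follows from the hypothesis, and for three letters in
    decreasing order it is the Jacobi identity in the form lb_hexagon.
    Finally F is made multilinear by keeping its values on the words in a basis of L that d maps
    into itself together with 0 (differential_basis): then x' and y' are again
    basis vectors or zero, so the exchange relation for basis words only
    involves values that are kept. *)

(** * Cancellation of sums in characteristic two *)

Section Char2Sums.
Variables (k : char2ClosedFieldType) (V : lmodType k).

(** Syntax of sums, so that cancellation of equal terms in pairs is decided by
    counting occurrences. *)
Inductive c2expr := C2zero | C2atom of nat | C2add of c2expr & c2expr.

Fixpoint c2eval (e : seq V) t : V :=
  match t with
  | C2zero => 0
  | C2atom i => nth 0 e i
  | C2add t u => c2eval e t + c2eval e u
  end.

Fixpoint c2atoms t : seq nat :=
  match t with
  | C2zero => [::]
  | C2atom i => [:: i]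
  | C2add t u => c2atoms t ++ c2atoms u
  end.

Lemma c2_solve e t u :
  (let p := c2atoms t ++ c2atoms u in all (fun i => ~~ odd (count_mem i p)) p) ->
  c2eval e t = c2eval e u.
Proof.
have evalE s : c2eval e s = \sum_(i <- c2atoms s) nth 0 e i.
  elim: s => [|i|s IH s' IH'] /=; rewrite ?big_nil ?big_seq1 //.
  by rewrite big_cat IH IH'.
move=> /allP even; apply: (addIr (c2eval e u)); rewrite Defs.addvv !evalE -big_cat.
rewrite -big_undup_iterop_count big_seq big1 // => i.
rewrite mem_undup => /even; rewrite -[iterop _ _ _ _]/(_ *+ count_mem i _).
move=> ev; rewrite -[count_mem i _]odd_double_half (negbTE ev) add0n.
by rewrite -muln2 mulrnA mulr2n Defs.addvv.
Qed.

(** In characteristic two an equation between sums is used by adding both of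
    its sides to the left of the goal; [char2] then cancels. *)
Lemma c2_use (a b x y : V) : a = b -> x + (a + b) = y -> x = y.
Proof. by move=> ->; rewrite Defs.addvv addr0. Qed.

End Char2Sums.

(* Atoms are compared up to conversion, because the same vector may be typed
   through different structures. *)
Ltac c2same a b := match goal with _ => constr_eq a b | _ => unify a b end.
Ltac c2mem a e :=
  match e with
  | nil => false
  | cons ?b _ => let _ := match goal with _ => c2same a b end in true
  | cons _ ?e => c2mem a e
  end.
Ltac c2find a e :=
  match e with
  | cons ?b _ => let _ := match goal with _ => c2same a b end in constr:(0%N)
  | cons _ ?e => let i := c2find a e in constr:(i.+1)
  end.
Ltac c2env t e :=
  lazymatch t with
  | @Algebra.add _ ?a ?b => let e := c2env a e in c2env b e
  | @Algebra.zero _ => e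
  | ?a => lazymatch c2mem a e with true => e | false => constr:(cons a e) end
  end.
Ltac c2reify t e :=
  lazymatch t with
  | @Algebra.add _ ?a ?b =>
      let a := c2reify a e in let b := c2reify b e in constr:(C2add a b)
  | @Algebra.zero _ => constr:(C2zero)
  | ?a => let i := c2find a e in constr:(C2atom i)
  end.
Ltac char2 :=
  lazymatch goal with |- @eq ?T ?a ?b =>
    let e := c2env a (@nil T) in let e := c2env b e in
    let ta := c2reify a e in let tb := c2reify b e in
    apply: (@c2_solve _ _ e ta tb); vm_compute; reflexivity
  end.
Tactic Notation "c2use" constr(h) := refine (c2_use h _).

(** * Bases of vector spaces with a differential *)

Section FreeSets.
Variables (k : fieldType) (V : lmodType k).
Implicit Types (S T U : V -> Prop) (p q : seq (k * V)) (x y : V).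

Definition lcomb (W : lmodType k) (f : V -> W) p : W :=
  \sum_(cv <- p) cv.1 *: f cv.2.

Definition over S p := forall cv, cv \in p -> S cv.2.

(** Linear independence of [S], stated as a universal property: every function
    on [S] respects the linear relations between its elements.  In this form
    extension by linearity is immediate. *)
Definition free_set S := forall (W : lmodType k) (f : V -> W) p,
  over S p -> lcomb id p = 0 -> lcomb f p = 0.

Definition spans S x := exists2 p, over S p & x = lcomb id p.

Lemma lcomb_cons (W : lmodType k) (f : V -> W) c p :
  lcomb f (c :: p) = c.1 *: f c.2 + lcomb f p.
Proof. exact: big_cons. Qed.

Lemma lcomb_cat (W : lmodType k) (f : V -> W) p q :
  lcomb f (p ++ q) = lcomb f p + lcomb f q.
Proof. exact: big_cat. Qed.

Lemma lcomb_scale (W : lmodType k) (f : V -> W) a p :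
  lcomb f [seq (a * cv.1, cv.2) | cv <- p] = a *: lcomb f p.
Proof.
rewrite /lcomb big_map scaler_sumr.
by apply: eq_bigr => cv _ /=; rewrite scalerA.
Qed.

Lemma lcomb_filter (W : lmodType k) (f : V -> W) (P : pred V) p :
  lcomb f p = lcomb f [seq cv <- p | P cv.2] + lcomb f [seq cv <- p | ~~ P cv.2].
Proof. by rewrite /lcomb !big_filter [LHS](bigID (fun cv => P cv.2)). Qed.

Lemma over_cat S p q : over S p -> over S q -> over S (p ++ q).
Proof. by move=> Sp Sq cv; rewrite mem_cat => /orP[/Sp|/Sq]. Qed.

Lemma over_scale S a p : over S p -> over S [seq (a * cv.1, cv.2) | cv <- p].
Proof. by move=> Sp _ /mapP[cv /Sp Scv ->]. Qed.

Lemma over_cons S c p : over S (c :: p) <-> S c.2 /\ over S p.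
Proof.
split=> [H|[Sc Sp] cv]; last by rewrite inE => /orP[/eqP->|/Sp].
by split=> [|cv pcv]; apply: H; rewrite inE ?eqxx // pcv orbT.
Qed.

Lemma over_sub S T p : (forall x, S x -> T x) -> over S p -> over T p.
Proof. by move=> ST Sp cv /Sp /ST. Qed.

(** A vector outside the span of a free set can be added to it: in a vanishing
    combination its total coefficient must be zero. *)
Lemma free_setU1 S x : free_set S -> ~ spans S x ->
  free_set (fun y => S y \/ y = x).
Proof.
move=> Sfree xS W f p pS p0.
have q1S : over S [seq cv <- p | cv.2 != x].
  move=> cv; rewrite mem_filter => /andP[/eqP cvx /pS].
  by case.
have coll (W' : lmodType k) (g : V -> W') :
    lcomb g [seq cv <- p | ~~ (cv.2 != x)] =
      (\sum_(cv <- p | ~~ (cv.2 != x)) cv.1) *: g x.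
  rewrite /lcomb big_filter scaler_suml; apply: eq_bigr => cv.
  by rewrite negbK => /eqP->.
move: p0; rewrite !(@lcomb_filter _ _ (fun y => y != x) p) !coll.
set c := \sum_(_ <- _ | _) _.
have [->|c0] := eqVneq c 0.
  by rewrite !scale0r !addr0; apply: Sfree.
move=> E; case: xS.
exists [seq (- c^-1 * cv.1, cv.2) | cv <- [seq cv <- p | cv.2 != x]].
  exact: over_scale.
rewrite lcomb_scale; have /eqP := E; rewrite addr_eq0 => /eqP ->.
by rewrite scalerN scaleNr opprK scalerA mulVf ?scale1r.
Qed.

(** Every vector of [U] is spanned by a maximal free set between [S] and [U];
    such a set exists by Zorn's lemma, since a vanishing combination over a
    union of a chain lives in one of its members. *)
Lemma free_extends S U : free_set S -> (forall x, S x -> U x) ->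
  exists T, [/\ free_set T, forall x, S x -> T x, forall x, T x -> U x &
    forall x, U x -> spans T x].
Proof.
move=> Sfree SU.
pose P (T : set V) :=
  (forall x, T x -> U x) /\ free_set (fun y => S y \/ T y).
have [F FP Ftot|A [[AU Afree] Amax]] := @Zorn_bigcup V P.
  split=> [x [X /FP[XU _] /XU] //|W f p pF].
  have [pS|[X FX pX]] : over S p \/ (exists2 X, F X & over (fun y => S y \/ X y) p).
  - elim: p pF => [_|c p IH]; first by left.
    move=> /over_cons[cSF /IH[pS|[X FX pX]]].
      case: cSF => [Sc|[X FX Xc]]; [left|right].
        exact/over_cons.
      exists X => //; apply/over_cons; split; first by right.
      by apply: over_sub pS => x; left.
    right; case: cSF => [Sc|[Y FY Yc]].
      by exists X => //; apply/over_cons; split; first by left.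
    case: (Ftot _ _ FX FY) => XY; [exists Y|exists X] => //;
      apply/over_cons; split=> //; [by right| |by right; apply: XY].
    by apply: over_sub pX => x [|/XY]; [left|right].
  - exact: Sfree.
  - by have [_] := FP _ FX; apply.
exists (fun y => S y \/ A y); split=> // [x|x [/SU|/AU]|x Ux] //.
  by left.
apply: contrapT => xS.
have xA : ~ A x.
  move=> Ax; apply: xS; exists [:: (1, x)].
    by apply/over_cons; split=> //; right.
  by rewrite lcomb_cons /lcomb big_nil scale1r addr0.
apply: (Amax (fun y => A y \/ y = x)).
  by split=> [y|sub]; [left|apply/xA/sub; right].
split=> [y [/AU|->]|W f p pS] //.
apply: (free_setU1 Afree xS).
by apply: over_sub pS => y [|[|]]; auto.
Qed.

End FreeSets.

Section LinearExtension.
Variables (k : fieldType) (V : lmodType k) (B : V -> Prop).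
Hypotheses (Bfree : free_set B) (Bspan : forall x, spans B x).

Definition bcomb (x : V) : seq (k * V) := s2val (cid2 (Bspan x)).

Lemma bcomb_over x : over B (bcomb x).
Proof. exact: s2valP. Qed.

Lemma bcombK x : lcomb id (bcomb x) = x.
Proof. exact/esym/(s2valP' (cid2 (Bspan x))). Qed.

Definition lin_ext (W : lmodType k) (f : V -> W) (x : V) : W :=
  lcomb f (bcomb x).

(** The extension is well defined because [B] is free: the difference of two
    combinations of the same vector vanishes. *)
Lemma lin_ext_comb (W : lmodType k) (f : V -> W) p :
  over B p -> lin_ext f (lcomb id p) = lcomb f p.
Proof.
move=> Bp; apply/eqP; rewrite -subr_eq0 -[X in _ - X]scale1r -scaleNr.
rewrite /lin_ext -lcomb_scale -lcomb_cat; apply/eqP/Bfree.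
  by apply: over_cat; [exact: bcomb_over | exact: over_scale].
by rewrite lcomb_cat lcomb_scale bcombK scaleN1r subrr.
Qed.

Lemma lin_ext_id (W : lmodType k) (f : V -> W) x : B x -> lin_ext f x = f x.
Proof.
move=> Bx; have -> : x = lcomb id [:: (1, x)].
  by rewrite lcomb_cons /lcomb big_nil scale1r addr0.
rewrite lin_ext_comb; last exact/over_cons.
by rewrite !lcomb_cons /lcomb !big_nil !scale1r !addr0.
Qed.

Lemma lin_ext_linear (W : lmodType k) (f : V -> W) : linear (lin_ext f).
Proof.
move=> a x y; rewrite -{1}[x]bcombK -{1}[y]bcombK -lcomb_scale -lcomb_cat.
rewrite lin_ext_comb; first by rewrite lcomb_cat lcomb_scale.
by apply: over_cat; [apply: over_scale|]; exact: bcomb_over.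
Qed.

Lemma lin_ext_fun_linear (W : lmodType k) (f g h : V -> W) a x :
  (forall b, f b = a *: g b + h b) -> 
  lin_ext f x = a *: lin_ext g x + lin_ext h x.
Proof.
move=> fgh; rewrite /lin_ext /lcomb scaler_sumr -big_split /=.
by apply: eq_bigr => cv _; rewrite fgh scalerDr !scalerA mulrC.
Qed.

End LinearExtension.

Section DifferentialBasis.
Variables (k : char2ClosedFieldType) (V : ver4Type k).

(** [V] is a sum of copies of [k] and of [k[d]/(d^2)]: a basis [D] of the image
    of [d] extends to a basis [T] of the kernel, and lifts [C] of the elements
    of [D] complete [T]. *)
Lemma differential_basis : exists B : V -> Prop,
  [/\ free_set B, forall x, spans B x & forall x, B x -> vd x = 0 \/ B (vd x)].
Proof.
have free0 : free_set (fun _ : V => False).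
  move=> W f [|c p] p0; last by case: (p0 c); rewrite mem_head.
  by rewrite /lcomb !big_nil.
have [D [Dfree _ Dim Dspan]] := @free_extends k V (fun=> False)
  (fun x => exists y, x = vd y) free0 (fun x => False_ind _).
have D_ker x : D x -> vd x = 0 by move=> /Dim[y ->]; exact: vdd.
have [T [Tfree DT Tker Tspan]] := @free_extends k V D (fun x => vd x = 0) Dfree D_ker.
have lift_ex x : exists y, D x -> x = vd y.
  by case: (pselect (D x)) => [/Dim[y xy]|?]; [exists y|exists 0].
have [l lE] := choice lift_ex.
pose C x := exists2 y, D y & x = l y.
have Dn0 y : D y -> y != 0.
  move=> Dy; apply/eqP => y0; have /eqP := oner_neq0 k; apply.
  have := @Dfree k^o (fun=> 1) [:: (1, y)].
  rewrite !lcomb_cons /lcomb !big_nil /= y0 scaler0 !addr0 scale1r; apply=> //.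
  by move=> cv; rewrite inE => /eqP->; rewrite /= -y0.
exists (fun x => T x \/ C x); split; last first.
- by move=> x [/Tker|[y Dy ->]]; [left|right; left; rewrite -(lE y Dy); apply: DT].
- move=> x; have [p pD xE] := Dspan (vd x) (ex_intro _ x erefl).
  pose y := \sum_(cv <- p) cv.1 *: l cv.2.
  have dy : vd y = vd x.
    rewrite xE /y /lcomb raddf_sum !big_seq; apply: eq_bigr => cv pcv.
    by rewrite /= linearZ /= -lE //; apply: pD.
  have /Tspan[q qT xyE] : vd (x - y) = 0 by rewrite raddfB /= dy subrr.
  exists (q ++ [seq (cv.1, l cv.2) | cv <- p]).
    apply: over_cat => [cv /qT|_ /mapP[cv pcv ->]]; first by left.
    by right; exists cv.2 => //; apply: pD.
  by rewrite lcomb_cat -xyE /lcomb big_map /= subrK.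
- move=> W f p pB p0.
  set pT := [seq cv <- p | vd cv.2 == 0].
  set pC := [seq cv <- p | vd cv.2 != 0].
  have E (W' : lmodType k) (g : V -> W') : lcomb g p = lcomb g pT + lcomb g pC.
    exact: (@lcomb_filter _ _ _ _ (fun v => vd v == 0)).
  have pT_over : over T pT.
    move=> cv; rewrite mem_filter => /andP[/eqP cv0 /pB] [//|[y Dy cvy]].
    by case/eqP: (Dn0 y Dy); rewrite (lE y Dy) -cvy.
  have pC_over : over C pC.
    by move=> cv; rewrite mem_filter => /andP[/eqP cv0 /pB] [/Tker|].
  have pC_lift cv : cv \in pC -> D (vd cv.2) /\ l (vd cv.2) = cv.2.
    by move=> /pC_over[y Dy ->]; rewrite -(lE y Dy).
  (* Applying [d] to the combination leaves a relation between elements of [D],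
     which any function on the lifts respects. *)
  have pC0 (W' : lmodType k) (g : V -> W') : lcomb g pC = 0.
    have dpC : lcomb id [seq (cv.1, vd cv.2) | cv <- pC] = 0.
      have : vd (lcomb id p) = 0 by rewrite p0 raddf0.
      rewrite E raddfD /=.
      have -> : vd (lcomb id pT) = 0.
        rewrite /lcomb raddf_sum big_seq big1 // => cv /pT_over/Tker cv0.
        by rewrite /= linearZ /= cv0 scaler0.
      rewrite add0r => <-; rewrite /lcomb big_map raddf_sum.
      by apply: eq_bigr => cv _; rewrite /= linearZ.
    have := @Dfree W' (g \o l) _ _ dpC; rewrite {1}/lcomb big_map /lcomb => H.
    rewrite -[RHS]H; last by move=> _ /mapP[cv /pC_lift[Dcv _] ->].
    by rewrite !big_seq; apply: eq_bigr => cv /pC_lift[_ /= ->].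
  rewrite E pC0 addr0; apply: Tfree => //.
  by have := E _ id; rewrite p0 pC0 addr0.
Qed.

End DifferentialBasis.

(** * Multilinear functions of words and linear maps on the tensor algebra *)

(** Linear in every letter of a word, for words of all lengths at once: no
    relation is imposed between the values on words of different lengths. *)
Definition multilinear (k : fieldType) (V W : lmodType k) (F : seq V -> W) :=
  forall u v a x y,
    F (u ++ (a *: x + y) :: v) = a *: F (u ++ x :: v) + F (u ++ y :: v).

Section MultilinearTheory.
Variables (k : fieldType) (V W : lmodType k) (F : seq V -> W).
Hypothesis Flin : multilinear F.

Lemma multilin0 u v : F (u ++ 0 :: v) = 0.
Proof.
by have := Flin u v (-1) 0 0; rewrite scaler0 addr0 scaleN1r addNr.
Qed.

Lemma multilin_mem0 w : 0 \in w -> F w = 0.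
Proof. by case/splitPr=> u v; exact: multilin0. Qed.

Lemma multilinD u v x y : F (u ++ (x + y) :: v) = F (u ++ x :: v) + F (u ++ y :: v).
Proof. by have := Flin u v 1 x y; rewrite !scale1r. Qed.

Lemma multilinZ u v a x : F (u ++ (a *: x) :: v) = a *: F (u ++ x :: v).
Proof. by have := Flin u v a x 0; rewrite multilin0 !addr0. Qed.

End MultilinearTheory.

Section MultilinearClosure.
Variables (k : fieldType) (V W : lmodType k).
Implicit Types (F G : seq V -> W).

Lemma multilin_add F G : multilinear F -> multilinear G ->
  multilinear (fun w => F w + G w).
Proof. by move=> Fl Gl u v a x y; rewrite Fl Gl scalerDr addrACA. Qed.

Lemma multilin_catl F r : multilinear F -> multilinear (fun w => F (r ++ w)).
Proof. by move=> Fl u v a x y; rewrite !catA Fl. Qed.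

Lemma multilin_catr F r : multilinear F -> multilinear (fun w => F (w ++ r)).
Proof. by move=> Fl u v a x y; rewrite -!catA Fl. Qed.

Lemma multilin_cons F z : multilinear F -> multilinear (fun w => F (z :: w)).
Proof. by move=> Fl u v a x y; rewrite -!cat_cons Fl. Qed.

(** Restricting a multilinear map to words of one length keeps it
    multilinear; this reduces statements about one length to all lengths. *)
Lemma multilin_size F m : multilinear F ->
  multilinear (fun w => if size w == m then F w else 0).
Proof.
move=> Fl u v a x y; rewrite !size_cat /= Fl.
by case: ifP => _; rewrite ?scaler0 ?addr0.
Qed.

Lemma multilin_letter (f : V -> W) : linear f ->
  multilinear (fun w => if w is [:: x] then f x else 0).
Proof.
by move=> fl [|z [|z' u]] [|t v] a x y /=; rewrite ?fl ?scaler0 ?addr0.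
Qed.

End MultilinearClosure.

Section MultilinearExtension.
Variables (k : fieldType) (V : lmodType k) (B : V -> Prop).
Hypotheses (Bfree : free_set B) (Bspan : forall x, spans B x).

Fixpoint multi_ext (W : lmodType k) (F : seq V -> W) (w : seq V) : W :=
  if w is x :: w' then
    lin_ext Bspan (fun b => multi_ext (fun s => F (b :: s)) w') x
  else F [::].

Lemma multi_ext_linear (W : lmodType k) (F : seq V -> W) : multilinear (multi_ext F).
Proof.
move=> u v a x y; elim: u F => [|z u IH] F /=; first exact: lin_ext_linear.
by apply: lin_ext_fun_linear => b; exact: IH.
Qed.

Lemma multi_ext_id (W : lmodType k) (F : seq V -> W) w :
  (forall x, x \in w -> B x) -> multi_ext F w = F w.
Proof.
elim: w F => [|x w IH] F //= Bw; rewrite lin_ext_id //; last first.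
  by apply: Bw; rewrite mem_head.
by apply: IH => y wy; apply: Bw; rewrite inE wy orbT.
Qed.

(** The letters are expanded in the basis from left to right, [u] being the
    part already in the basis. *)
Lemma multi_zero (W : lmodType k) (F : seq V -> W) : multilinear F ->
  (forall w, (forall x, x \in w -> B x) -> F w = 0) -> forall w, F w = 0.
Proof.
move=> Flin F0 w; suff H u : (forall x, x \in u -> B x) -> F (u ++ w) = 0.
  exact: (H [::]).
elim: w u => [|x w IH] u Bu; first by rewrite cats0; exact: F0.
rewrite -(bcombK Bspan x); move: (@bcomb_over _ _ _ Bspan x).
elim: (bcomb Bspan x) => [|c p IHp].
  by rewrite /lcomb big_nil => _; apply: multilin_mem0; rewrite // mem_cat mem_head orbT.
move=> /over_cons[Bc /IHp]; rewrite lcomb_cons Flin => ->.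
rewrite addr0 -cat_rcons IH ?scaler0 // => y.
by rewrite mem_rcons inE => /orP[/eqP->|/Bu].
Qed.

End MultilinearExtension.

Section TensorMultilinear.
Variables (k : char2ClosedFieldType) (V : ver4Type k) (W : lmodType k).
Variable F : seq V -> W.
Hypothesis Flin : multilinear F.

(** A multilinear function extends linearly to the tensor algebra.  The
    universal property of the latter only concerns algebras, hence the detour
    by the expansion of a formal expression into words. *)
Fixpoint texpand (t : tterm V) : seq (k * seq V) :=
  match t with
  | tgen x => [:: (1, [:: x])]
  | tzero => [::]
  | tone => [:: (1, [::])]
  | tadd t u => texpand t ++ texpand u
  | tscale a t => [seq (a * c.1, c.2) | c <- texpand t]
  | tmul t u => [seq (c.1 * d.1, c.2 ++ d.2) | c <- texpand t, d <- texpand u]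
  end.

Definition expand_val (u v : seq V) (p : seq (k * seq V)) : W :=
  \sum_(c <- p) c.1 *: F (u ++ c.2 ++ v).

Let ev_cat u v p q : expand_val u v (p ++ q) = expand_val u v p + expand_val u v q.
Proof. exact: big_cat. Qed.

Let ev_scale u v a p :
  expand_val u v [seq (a * c.1, c.2) | c <- p] = a *: expand_val u v p.
Proof.
rewrite /expand_val big_map scaler_sumr.
by apply: eq_bigr => c _; rewrite scalerA.
Qed.

Let ev_mull u v p q :
  expand_val u v [seq (c.1 * d.1, c.2 ++ d.2) | c <- p, d <- q] =
  \sum_(c <- p) c.1 *: expand_val (u ++ c.2) v q.
Proof.
rewrite /expand_val big_allpairs_dep; apply: eq_bigr => c _.
by rewrite scaler_sumr; apply: eq_bigr => d _; rewrite scalerA !catA.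
Qed.

Let ev_mulr u v p q :
  expand_val u v [seq (c.1 * d.1, c.2 ++ d.2) | c <- p, d <- q] =
  \sum_(d <- q) d.1 *: expand_val u (d.2 ++ v) p.
Proof.
rewrite ev_mull /expand_val; under eq_bigr do rewrite scaler_sumr.
rewrite exchange_big; apply: eq_bigr => d _; rewrite scaler_sumr.
by apply: eq_bigr => c _; rewrite !scalerA mulrC !catA.
Qed.

Let ev1 u v a s : expand_val u v [:: (a, s)] = a *: F (u ++ s ++ v).
Proof. by rewrite /expand_val big_seq1. Qed.

(** The words [u] and [v] around the expansion make the induction go through
    for products. *)
Lemma expand_cong t t' : tcong t t' -> forall u v,
  expand_val u v (texpand t) = expand_val u v (texpand t').
Proof.
elim=> {t t'} /=.
- by [].
- by move=> t t' _ IH u v; rewrite IH.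
- by move=> t t' t'' _ IH _ IH' u v; rewrite IH IH'.
- by move=> t t' s s' _ IH _ IH' u v; rewrite !ev_cat IH IH'.
- by move=> a t t' _ IH u v; rewrite !ev_scale IH.
- move=> t t' s s' _ IH _ IH' u v; rewrite ev_mull.
  under eq_bigr do rewrite IH'.
  by rewrite -ev_mull !ev_mulr; apply: eq_bigr => c _; rewrite IH.
- by move=> t s r u v; rewrite catA.
- by move=> t s u v; rewrite !ev_cat addrC.
- by [].
- by move=> t u v; rewrite ev_scale scale0r /expand_val big_nil.
- by move=> t u v; rewrite ev_scale scale1r.
- by move=> a b t u v; rewrite !ev_scale scalerA.
- by move=> a t s u v; rewrite map_cat.
- by move=> a b t u v; rewrite ev_cat !ev_scale scalerDl.
- move=> t s r u v; rewrite ev_mull [RHS]ev_mull big_allpairs_dep.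
  apply: eq_bigr => c _; rewrite ev_mull scaler_sumr.
  by apply: eq_bigr => d _; rewrite /= scalerA catA.
- by move=> t u v; rewrite cats0 ev_scale scale1r.
- move=> t u v; rewrite [LHS](ev_mulr u v _ [:: (1, [::])]) big_seq1 scale1r.
  by [].
- by move=> t s r u v; rewrite ev_cat !ev_mull big_cat.
- by move=> t s r u v; rewrite ev_cat !ev_mulr big_cat.
- by move=> a t s u v; rewrite ev_scale !ev_mulr scaler_sumr; apply: eq_bigr => d _;
    rewrite ev_scale !scalerA mulrC.
- by move=> a t s u v; rewrite ev_scale !ev_mull scaler_sumr; apply: eq_bigr => d _;
    rewrite ev_scale !scalerA mulrC.
- move=> x y u v; rewrite [RHS](ev_cat u v [:: (1, [:: x])]) !ev1 !scale1r.
  exact: multilinD.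
- by move=> a x u v; rewrite /= !ev1 mulr1 scale1r; exact: multilinZ.
Qed.

Definition tensor_ext (a : tensor_alg V) : W :=
  expand_val [::] [::] (texpand (repr a)).

Let tensor_extE t : tensor_ext (tcl t) = expand_val [::] [::] (texpand t).
Proof. exact/expand_cong/tcl_repr. Qed.

Lemma tensor_ext_linear : linear tensor_ext.
Proof.
move=> c a b; case: (tcl_surj a) => t ->; case: (tcl_surj b) => s ->.
by rewrite -tcl_scale -tcl_add !tensor_extE /= ev_cat ev_scale.
Qed.

Lemma tensor_ext_word w : tensor_ext (\prod_(x <- w) tin x) = F w.
Proof.
pose t : tterm V := foldr (fun x s => tmul (tgen x) s) tone w.
have -> : \prod_(x <- w) tin x = tcl t.
  rewrite {}/t; elim: w => [|x w IH] /=; first by rewrite big_nil tcl1.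
  by rewrite big_cons IH tcl_mul.
have -> : F w = expand_val [::] [::] [:: (1, w)] by rewrite ev1 cats0 scale1r.
rewrite tensor_extE; congr (expand_val _ _ _); rewrite {}/t.
by elim: w => [|x w IH] //=; rewrite IH /= mulr1.
Qed.

End TensorMultilinear.

(** * Consequences of the Jacobi identity *)

Section LieIdentities.
Variables (k : char2ClosedFieldType) (L : olieType k).
Implicit Types x y z : L.

Lemma lbC_closed x y : vd x = 0 -> lb x y = lb y x.
Proof.
by move=> x0; c2use (lb_anti x y); rewrite x0 lb0r; char2.
Qed.

Lemma lbC_closedr x y : vd y = 0 -> lb x y = lb y x.
Proof. by move=> /lbC_closed->. Qed.

Hypothesis sq0 : forall x, vd x = 0 -> lb x x = 0.

(** The bracket [x,x] only depends on dx, so that replacing x'x' by [x,x] is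
    unambiguous. *)
Lemma lb_sq_vd x y : vd x = vd y -> lb x x = lb y y.
Proof.
move=> xy; have xyc : vd (x + y) = 0 by rewrite raddfD /= xy Defs.addvv.
c2use (sq0 xyc); rewrite lbDl !lbDr; c2use (lb_anti x y).
rewrite xy (sq0 (vdd y)); char2.
Qed.

(** In U(L) the element z'z' equals [z,z], so its commutator with x is obtained
    by bracketing twice with z'. *)
Lemma lb_sq_jacobi x z : lb (lb z z) x = lb (lb (vd z) x) (vd z).
Proof.
c2use (lb_jacobi z z x).
c2use (lb_jacobi (vd z) z (vd x)); rewrite !vdd !lb0l !lb0r.
have := congr1 (fun a => lb a z) (lb_anti z x); rewrite !lbDl lb0l => h.
c2use h; rewrite (lbC_closedr z (vdd x)); char2.
Qed.

(** The Jacobi identity in the form in which it is met when three letters are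
    sorted in two ways: it has [x,z] in place of [z,x], and the terms with
    differentials are adapted by the Jacobi identity for z', x', y. *)
Lemma lb_hexagon x y z :
  lb (lb x y) z + lb (lb y z) x + lb (lb x z) y + lb (lb (vd y) z) (vd x)
  + lb (lb y (vd z)) (vd x) + lb (lb (vd z) x) (vd y) = 0.
Proof.
c2use (lb_jacobi x y z); c2use (lb_jacobi (vd z) (vd x) y).
rewrite !vdd !lb0l !lb0r.
have := congr1 (fun a => lb a y) (lb_anti x z); rewrite !lbDl lb0l => h.
c2use h; rewrite (lbC_closedr y (vdd z)) (lbC_closed y (vdd x)).
rewrite (lbC_closedr y (vdd x)); char2.
Qed.

End LieIdentities.

(** * The exchange relation on words *)

Lemma strict_total_order (T : eqType) : exists lt : rel T,
  [/\ transitive lt, irreflexive lt & forall x y, [|| lt x y, x == y | lt y x]].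
Proof.
have [R Rwo] := well_ordering_principle T.
have Rc : wo_chain R predT by move=> A _; exact: Rwo.
have tot : total R by move=> x y; exact: (wo_chainW Rc).
have anti : antisymmetric R by move=> x y; exact: (wo_chain_antisymmetric Rc).
have trans : transitive R.
  move=> y x z xy yz.
  have [|m [[mA mlb] _]] := Rwo [pred t | t \in [:: x; y; z]].
    by exists x; rewrite !inE eqxx.
  have mx : R m x by apply: mlb; rewrite !inE eqxx.
  have my : R m y by apply: mlb; rewrite !inE eqxx orbT.
  have mz : R m z by apply: mlb; rewrite !inE eqxx !orbT.
  move: mA; rewrite !inE => /or3P[] /eqP E; move: mx my mz; rewrite E => //.
    by move=> yx _ _; rewrite (anti x y) // xy yx.
  by move=> zx zy _; have <- : y = z by apply: anti; rewrite yz zy.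
exists (fun x y => R x y && (x != y)); split=> [y x z|x|x y].
- move=> /andP[xy nxy] /andP[yz nyz]; rewrite (trans _ _ _ xy yz) /=.
  apply: contraNneq nxy => xz; apply/eqP/anti.
  by rewrite xy xz yz.
- by rewrite eqxx andbF.
- by have [->|nxy] := eqVneq x y; rewrite ?orbT // !andbT; exact: tot.
Qed.

Lemma cat2_eqP (T : Type) (u v u' v' : seq T) a b c d :
  u ++ a :: b :: v = u' ++ c :: d :: v' ->
  [\/ [/\ u = u', a = c, b = d & v = v'],
      [/\ u' = u ++ [:: a], b = c & v = d :: v'] \/
      [/\ u = u' ++ [:: c], d = a & v' = b :: v],
      exists2 m, u' = u ++ a :: b :: m & v = m ++ c :: d :: v' |
      exists2 m, u = u' ++ c :: d :: m & v' = m ++ a :: b :: v].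
Proof.
elim: u u' => [|e u IH] [|f u'] /=.
- by case=> -> -> ->; apply: Or41.
- case: u' => [|g m] /= [-> ->]; first by move=> -> ; apply: Or42; left.
  by move=> ->; apply: Or43; exists m.
- case: u {IH} => [|g m] /= [-> <-]; first by move=> <-; apply: Or42; right.
  by move=> <-; apply: Or44; exists m.
- case=> -> /IH[[-> -> -> ->]|[[-> -> ->]|[-> -> ->]]|[m -> ->]|[m -> ->]].
  + exact: Or41.
  + by apply: Or42; left.
  + by apply: Or42; right.
  + by apply: Or43; exists m.
  + by apply: Or44; exists m.
Qed.

(** The function [om] stands for the class of the product of a word in TL modulo
    relations inside degree [n]; words of length [n.+1] are exchanged at the
    cost of words of length [n]. *)
Section WordPotential.
Variables (k : char2ClosedFieldType) (L : olieType k) (Q : lmodType k).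
Variables (n : nat) (om : seq L -> Q).
Hypothesis sq0 : forall x : L, vd x = 0 -> lb x x = 0.
Hypothesis om_lin : multilinear om.
Hypothesis om_rel : forall u v (x y : L), size (u ++ x :: y :: v) = n ->
  om (u ++ x :: y :: v) + om (u ++ y :: x :: v) + om (u ++ vd y :: vd x :: v)
  = om (u ++ lb x y :: v).

Variable lt : rel L.
Hypotheses (lt_trans : transitive lt) (lt_irr : irreflexive lt).
Hypothesis lt_total : forall x y, [|| lt x y, x == y | lt y x].

Implicit Types (u v w m : seq L) (x y z t : L).

Definition open_letters w := count (fun x => vd x != 0) w.

Fixpoint inversions w : nat :=
  if w is x :: s then (count (lt^~ x) s + inversions s)%N else 0%N.

(** An exchange produces one word with fewer inversions, and one with fewer
    open letters (letters outside ker d) unless a letter becomes zero.  The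
    factor makes the count of open letters dominate. *)
Definition weight w := (open_letters w * (size w ^ 2).+1 + inversions w)%N.

Lemma inversions_le w : (inversions w <= size w ^ 2)%N.
Proof.
elim: w => //= x w; have := count_size (lt^~ x) w; nia.
Qed.

Lemma weight_swap u v x y : lt y x ->
  (weight (u ++ y :: x :: v) < weight (u ++ x :: y :: v))%N.
Proof.
move=> yx; have nxy : lt x y = false.
  by apply/negP => xy; have := lt_trans yx xy; rewrite lt_irr.
rewrite /weight !size_cat /= /open_letters !count_cat /=.
set a := (_ * _)%N; set b := (_ * _)%N; have -> : a = b by rewrite /a /b; lia.
rewrite ltn_add2l; elim: u {a b} => [|z u IH] /=; first by rewrite yx nxy; lia.
rewrite !count_cat /=; lia.
Qed.

Lemma weight_open w w' : size w = size w' ->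
  (open_letters w < open_letters w')%N -> (weight w < weight w')%N.
Proof.
move=> sww lo; rewrite /weight sww; have := inversions_le w; rewrite sww.
nia.
Qed.

(** [Square u x v] is indexed by a lift [x] of the repeated letter. *)
Inductive redex := Swap of seq L & L & L & seq L | Square of seq L & L & seq L.

Definition source (r : redex) : seq L :=
  match r with
  | Swap u x y v => u ++ x :: y :: v
  | Square u x v => u ++ vd x :: vd x :: v
  end.

Definition reducible (r : redex) : bool := if r is Swap _ x y _ then lt y x else true.

Definition reduct (F : seq L -> Q) (r : redex) : Q :=
  match r with
  | Swap u x y v =>
      F (u ++ y :: x :: v) + F (u ++ vd y :: vd x :: v) + om (u ++ lb x y :: v)
  | Square u x v => om (u ++ lb x x :: v)
  end.

Definition redex_start (r : redex) : nat :=
  match r with Swap u _ _ _ | Square u _ _ => size u end.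

Definition redex_of w r := reducible r /\ source r = w.

Definition pick_redex w : option redex :=
  if pselect (exists r, redex_of w r) is left h then Some (sval (cid h)) else None.

(** Words with a letter zero get the value zero, as multilinearity will require;
    irreducible words may get any value, and zero is chosen. *)
Fixpoint fuel_potential (f : nat) w : Q :=
  if 0 \in w then 0 else
  if f is f'.+1 then
    if pick_redex w is Some r then reduct (fuel_potential f') r else 0
  else 0.

Definition potential w := fuel_potential (weight w).+1 w.

Lemma fuel_potential0 f w : 0 \in w -> fuel_potential f w = 0.
Proof. by move=> w0; case: f => [|f] /=; rewrite w0. Qed.

Lemma potential0 w : 0 \in w -> potential w = 0.
Proof. exact: fuel_potential0. Qed.

(** Applying [d] to two adjacent letters, when this does not produce a zero
    letter, makes both of them closed. *)
Lemma open_letters_vd u v x y :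
  (0 \in u ++ vd y :: vd x :: v) ||
  (open_letters (u ++ vd y :: vd x :: v) < open_letters (u ++ x :: y :: v))%N.
Proof.
rewrite mem_cat !inE /open_letters !count_cat /= !vdd eqxx /= ![0 == _]eq_sym.
case: (vd x == 0) => /=; first by rewrite !orbT.
case: (vd y == 0) => /=; first by rewrite !orbT.
by apply/orP; right; lia.
Qed.

(** The recursion stops: reducts have smaller weight, except that the word with
    differentiated letters may instead contain zero. *)
Lemma fuel_potential_stable f f' w : (weight w < f)%N -> (weight w < f')%N ->
  fuel_potential f w = fuel_potential f' w.
Proof.
elim: f f' w => [|f IH] [|f'] w //= wf wf'; case: ifP => // w0.
rewrite /pick_redex; case: pselect => // h; case: (cid h) => /= r [].
case: r => [u x y v|u x v] //= yx rw.
have lew : (weight (u ++ y :: x :: v) < weight w)%N by rewrite -rw weight_swap.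
congr (_ + _ + _); first by apply: IH; apply: leq_trans lew _; rewrite -ltnS.
case/orP: (open_letters_vd u v x y) => [z0|lo]; first by rewrite !fuel_potential0.
have led : (weight (u ++ vd y :: vd x :: v) < weight w)%N.
  by apply: weight_open; rewrite -rw // !size_cat.
by apply: IH; apply: leq_trans led _; rewrite -ltnS.
Qed.

Definition consistent w :=
  forall r, redex_of w r -> potential w = reduct potential r.

Lemma potential_pick w r : 0 \notin w -> pick_redex w = Some r ->
  potential w = reduct potential r.
Proof.
move=> /negbTE w0 wr; rewrite {1}/potential /= w0 wr.
move: wr; rewrite /pick_redex; case: pselect => // h [<-].
case: (cid h) => /= {}r []; case: r => [u x y v|u x v] //= yx rw.
have lew : (weight (u ++ y :: x :: v) < weight w)%N by rewrite -rw weight_swap.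
congr (_ + _ + _); first exact: fuel_potential_stable.
case/orP: (open_letters_vd u v x y) => [z0|lo]; first by rewrite potential0 // fuel_potential0.
have led : (weight (u ++ vd y :: vd x :: v) < weight w)%N.
  by apply: weight_open; rewrite -rw // !size_cat.
exact: fuel_potential_stable.
Qed.

(* Comparing summands up to conversion must not unfold the recursion. *)
Opaque potential.

Definition exchange u x y v :=
  potential (u ++ x :: y :: v) + potential (u ++ y :: x :: v)
  + potential (u ++ vd y :: vd x :: v) = om (u ++ lb x y :: v).

Lemma exchange0 u x y v : 0 \in u ++ x :: y :: v -> exchange u x y v.
Proof.
move=> w0; rewrite /exchange.
have om0 : om (u ++ lb x y :: v) = 0.
  move: w0; rewrite mem_cat !inE => /or4P[u0|/eqP<-|/eqP<-|v0].
  - by apply: multilin_mem0 => //; rewrite mem_cat u0.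
  - by rewrite lb0l multilin0.
  - by rewrite lb0r multilin0.
  - by apply: multilin_mem0 => //; rewrite mem_cat inE v0 !orbT.
rewrite om0 !potential0 ?addr0 //.
  move: w0; rewrite !mem_cat !inE => /or4P[->//|/eqP<-|/eqP<-|->]; rewrite ?orbT //;
    by rewrite raddf0 eqxx ?orbT.
by move: w0; rewrite !mem_cat !inE => /or4P[->//|->|->|->]; rewrite ?orbT.
Qed.

Lemma consistent0 w : 0 \in w -> consistent w.
Proof.
move=> w0 [u x y v|u x v] [/= yx rw].
  rewrite -rw in w0 *; have := exchange0 w0; rewrite /exchange => <-.
  by rewrite /=; char2.
rewrite potential0 //; move: w0; rewrite -rw mem_cat !inE => /or4P[u0|/eqP x0|/eqP x0|v0].
- by rewrite multilin_mem0 // mem_cat u0.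
- by rewrite sq0 ?multilin0.
- by rewrite sq0 ?multilin0.
- by rewrite multilin_mem0 // mem_cat inE v0 !orbT.
Qed.

Lemma swap_consistent u x y v : consistent (u ++ x :: y :: v) -> lt y x ->
  exchange u x y v.
Proof.
move=> C yx; have /= E := C (Swap u x y v) (conj yx erefl).
by rewrite /exchange E; char2.
Qed.

Lemma square_consistent u x v : consistent (u ++ vd x :: vd x :: v) ->
  potential (u ++ vd x :: vd x :: v) = om (u ++ lb x x :: v).
Proof. by move=> C; apply: (C (Square u x v) (conj isT erefl)). Qed.

(** Words whose value is known to obey the equation, in an induction on the
    number of open letters; those that contain zero obey it trivially. *)
Definition low c w := (0 \in w) || (open_letters w < c)%N.

Lemma low_swap c u v x y : low c (u ++ x :: y :: v) -> low c (u ++ y :: x :: v).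
Proof.
rewrite /low /open_letters !mem_cat !inE !count_cat /=.
by rewrite [(0 == x) || _]orbCA [(_ + (_ + count _ v))%N]addnCA.
Qed.

Lemma low_vd c u v x y : low c (u ++ x :: y :: v) -> low c (u ++ vd y :: vd x :: v).
Proof.
case/orP: (open_letters_vd u v x y) => [w0 _|lo]; first by rewrite /low w0.
case/orP=> [w0|lo']; last by apply/orP; right; apply: ltn_trans lo lo'.
rewrite /low; apply/orP; left; move: w0; rewrite !mem_cat !inE.
by case/or4P=> [->//|/eqP<-|/eqP<-|->]; rewrite ?raddf0 ?eqxx ?orbT.
Qed.

Section FewOpenLetters.
Variable c : nat.
Hypothesis low_consistent : forall w, size w = n.+1 -> low c w -> consistent w.

Let size_swap u x y v : size (u ++ y :: x :: v) = size (u ++ x :: y :: v).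
Proof. by rewrite !size_cat. Qed.

(** For closed letters the relation reads F(xy) + F(yx) = [x,y], which is
    symmetric in x and y since the bracket is, and which holds for x = y by
    the hypothesis on squares. *)
Lemma exchange_closed u x y v : size (u ++ x :: y :: v) = n.+1 ->
  low c (u ++ x :: y :: v) -> vd x = 0 -> vd y = 0 -> exchange u x y v.
Proof.
move=> s lo x0 y0; have P0 : potential (u ++ 0 :: 0 :: v) = 0.
  by apply: potential0; rewrite mem_cat mem_head orbT.
case/or3P: (lt_total y x) => [yx|/eqP yx|xy].
- by apply: swap_consistent => //; apply: low_consistent.
- by rewrite /exchange yx x0 P0 sq0 // multilin0 //; char2.
- have E : exchange u y x v.
    apply: swap_consistent => //; apply: low_consistent; last exact: low_swap.
    by rewrite size_swap.
  move: E; rewrite /exchange x0 y0 P0 (lbC_closed x y0) => <-; char2.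
Qed.

(** Exchanging the letters the other way changes the relation by the one for the
    pair y', x', up to the antisymmetry of the bracket; for equal letters it is
    the value of a square. *)
Lemma exchange_low u x y v : size (u ++ x :: y :: v) = n.+1 ->
  low c (u ++ x :: y :: v) -> exchange u x y v.
Proof.
move=> s lo; have sd : size (u ++ vd y :: vd x :: v) = n.+1 by rewrite -s !size_cat.
case/or3P: (lt_total y x) => [yx|/eqP yx|xy].
- by apply: swap_consistent => //; apply: low_consistent.
- move: s lo sd; rewrite yx => s lo sd; rewrite /exchange square_consistent //.
    char2.
  by apply: low_consistent => //; exact: low_vd.
- have E1 : exchange u y x v.
    apply: swap_consistent => //; apply: low_consistent; last exact: low_swap.
    by rewrite size_swap.
  have E2 := exchange_closed sd (low_vd lo) (vdd _) (vdd _).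
  have E3 : om (u ++ lb x y :: v) + om (u ++ lb y x :: v)
            + om (u ++ lb (vd y) (vd x) :: v) = 0.
    by rewrite -!(multilinD om_lin) lb_anti multilin0.
  have E4 : potential (u ++ vd (vd x) :: vd (vd y) :: v) = 0.
    by apply: potential0; rewrite vdd mem_cat mem_head orbT.
  rewrite /exchange; c2use E1; c2use E2; c2use E3; c2use E4; char2.
Qed.

Lemma exchange_low0 u x y v : size (u ++ x :: y :: v) = n.+1 ->
  low c (u ++ x :: y :: v) -> vd x = 0 \/ vd y = 0 ->
  potential (u ++ x :: y :: v) + potential (u ++ y :: x :: v) = om (u ++ lb x y :: v).
Proof.
move=> s lo xy0; rewrite -(exchange_low s lo) [potential (_ ++ vd y :: _)]potential0 ?addr0 //.
by rewrite mem_cat !inE; case: xy0 => ->; rewrite eqxx ?orbT.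
Qed.

End FewOpenLetters.

(** The induction hypothesis of the main induction, on the weight. *)
Definition below w := forall w', size w' = n.+1 ->
  (weight w' < weight w)%N -> consistent w'.

Lemma below_low w : size w = n.+1 -> below w ->
  forall w', size w' = n.+1 -> low (open_letters w) w' -> consistent w'.
Proof.
move=> sw Bw w' sw' /orP[|lo]; first exact: consistent0.
by apply: Bw => //; apply: weight_open => //; rewrite sw.
Qed.

Lemma swap_below w u x y v : below w -> size (u ++ x :: y :: v) = n.+1 ->
  (weight (u ++ x :: y :: v) < weight w)%N -> lt y x -> exchange u x y v.
Proof. by move=> Bw s lo; apply: swap_consistent; apply: Bw. Qed.

Lemma square_below w u x v : below w -> size (u ++ vd x :: vd x :: v) = n.+1 ->
  (weight (u ++ vd x :: vd x :: v) < weight w)%N ->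
  potential (u ++ vd x :: vd x :: v) = om (u ++ lb x x :: v).
Proof. by move=> Bw s lo; apply: square_consistent; apply: Bw. Qed.

Lemma square_low w u x v : size w = n.+1 -> below w ->
  size (u ++ vd x :: vd x :: v) = n.+1 ->
  low (open_letters w) (u ++ vd x :: vd x :: v) ->
  potential (u ++ vd x :: vd x :: v) = om (u ++ lb x x :: v).
Proof. by move=> sw Bw s lo; apply: square_consistent; apply: below_low lo. Qed.

Ltac size_tac s := by move: s; rewrite ?size_cat /= ?size_cat /= ?size_cat /=; lia.

Let omD u v x y : om (u ++ (x + y) :: v) = om (u ++ x :: v) + om (u ++ y :: v).
Proof. exact: multilinD. Qed.

Let omD1 u v a x y : om (u ++ a :: (x + y) :: v) =
  om (u ++ a :: x :: v) + om (u ++ a :: y :: v).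
Proof. by have := omD (u ++ [:: a]) v x y; rewrite -!catA. Qed.

(** Two exchanges at distant places commute up to the relations between the
    words of length [n]. *)
Lemma confluent_disjoint_swaps u x y m z t v :
  let w := u ++ x :: y :: m ++ z :: t :: v in
  size w = n.+1 -> below w -> lt y x -> lt t z ->
  reduct potential (Swap u x y (m ++ z :: t :: v)) =
  reduct potential (Swap (u ++ x :: y :: m) z t v).
Proof.
move=> w s Bw yx tz; rewrite /w in s.
have E1 : exchange (u ++ y :: x :: m) z t v.
  apply: (swap_below Bw) => //; first by rewrite -catA; size_tac s.
  by rewrite -catA /=; exact: weight_swap.
have E2 : exchange (u ++ vd y :: vd x :: m) z t v.
  apply: (exchange_low (below_low s Bw)); first by rewrite -catA; size_tac s.
  by rewrite -catA; exact: open_letters_vd.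
have E3 : exchange u x y (m ++ t :: z :: v).
  apply: (swap_below Bw) => //; first by size_tac s.
  have := @weight_swap (u ++ x :: y :: m) v z t tz.
  by rewrite -!catA.
have E4 : exchange u x y (m ++ vd t :: vd z :: v).
  apply: (exchange_low (below_low s Bw)); first by size_tac s.
  by have := @open_letters_vd (u ++ x :: y :: m) v z t; rewrite -!catA.
have O1 := @om_rel u (m ++ lb z t :: v) x y.
have O2 := @om_rel (u ++ lb x y :: m) v z t.
move: E1 E2 O1 O2; rewrite /exchange -!catA /= => E1 E2 O1 O2.
have {}O1 := O1 ltac:(size_tac s).
have {}O2 := O2 ltac:(size_tac s).
rewrite /= -!catA /=; c2use E1; c2use E2; c2use E3; c2use E4; c2use O1; c2use O2; char2.
Qed.

Let vd_sq x : vd (lb x x) = 0.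
Proof. by rewrite vd_lb (lbC_closed x (vdd x)) Defs.addvv. Qed.

(** The relation for the pair x, x, in which the words with x x cancel. *)
Let om_sq u v x : size (u ++ vd x :: vd x :: v) = n ->
  om (u ++ vd x :: vd x :: v) = om (u ++ lb x x :: v).
Proof.
move=> s; have <- : om (u ++ x :: x :: v) + om (u ++ x :: x :: v)
    + om (u ++ vd x :: vd x :: v) = om (u ++ lb x x :: v).
  by apply: om_rel; rewrite -s !size_cat.
char2.
Qed.

Lemma confluent_disjoint_swap_square u x y m z v :
  let w := u ++ x :: y :: m ++ vd z :: vd z :: v in
  size w = n.+1 -> below w -> lt y x ->
  reduct potential (Swap u x y (m ++ vd z :: vd z :: v)) =
  reduct potential (Square (u ++ x :: y :: m) z v).
Proof.
move=> w s Bw yx; rewrite /w in s.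
have E1 : potential (u ++ y :: x :: m ++ vd z :: vd z :: v)
    = om (u ++ y :: x :: m ++ lb z z :: v).
  have := @square_below _ (u ++ y :: x :: m) z v Bw; rewrite -!catA /=; apply.
    by size_tac s.
  exact: weight_swap.
have E2 : potential (u ++ vd y :: vd x :: m ++ vd z :: vd z :: v)
    = om (u ++ vd y :: vd x :: m ++ lb z z :: v).
  have := @square_low _ (u ++ vd y :: vd x :: m) z v s Bw; rewrite -!catA /=; apply.
    by size_tac s.
  exact: open_letters_vd.
have O1 := @om_rel u (m ++ lb z z :: v) x y ltac:(size_tac s).
have O2 := @om_sq (u ++ lb x y :: m) v z.
move: O2; rewrite -!catA /= => O2; have {}O2 := O2 ltac:(size_tac s).
rewrite /= -!catA /=; c2use E1; c2use E2; c2use O1; c2use O2; char2.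
Qed.

Lemma confluent_disjoint_square_swap u x m z t v :
  let w := u ++ vd x :: vd x :: m ++ z :: t :: v in
  size w = n.+1 -> below w -> lt t z ->
  reduct potential (Square u x (m ++ z :: t :: v)) =
  reduct potential (Swap (u ++ vd x :: vd x :: m) z t v).
Proof.
move=> w s Bw tz; rewrite /w in s.
have E1 : potential (u ++ vd x :: vd x :: m ++ t :: z :: v)
    = om (u ++ lb x x :: m ++ t :: z :: v).
  apply: (square_below Bw); first by size_tac s.
  have := @weight_swap (u ++ vd x :: vd x :: m) v z t tz.
  by rewrite -!catA.
have E2 : potential (u ++ vd x :: vd x :: m ++ vd t :: vd z :: v)
    = om (u ++ lb x x :: m ++ vd t :: vd z :: v).
  apply: (square_low s Bw); first by size_tac s.
  by have := @open_letters_vd (u ++ vd x :: vd x :: m) v z t; rewrite -!catA.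
have O1 := @om_sq u (m ++ lb z t :: v) x ltac:(size_tac s).
have O2 := @om_rel (u ++ lb x x :: m) v z t.
move: O2; rewrite -!catA /= => O2; have {}O2 := O2 ltac:(size_tac s).
rewrite /= -!catA /=; c2use E1; c2use E2; c2use O1; c2use O2; char2.
Qed.

Lemma confluent_disjoint_squares u x m z v :
  size (u ++ vd x :: vd x :: m ++ vd z :: vd z :: v) = n.+1 ->
  reduct potential (Square u x (m ++ vd z :: vd z :: v)) =
  reduct potential (Square (u ++ vd x :: vd x :: m) z v).
Proof.
move=> s; have O1 := @om_sq u (m ++ lb z z :: v) x ltac:(size_tac s).
have O2 := @om_sq (u ++ lb x x :: m) v z.
move: O2; rewrite -!catA /= => O2; have {}O2 := O2 ltac:(size_tac s).
rewrite /= -!catA /=; c2use O1; c2use O2; char2.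
Qed.

(** For three equal letters x' the discrepancy is [[x,x],x'] = [[x',x'],x'],
    which vanishes by the hypothesis on squares. *)
Lemma confluent_overlap_squares u x v :
  size (u ++ vd x :: vd x :: vd x :: v) = n.+1 ->
  reduct potential (Square u x (vd x :: v)) =
  reduct potential (Square (u ++ [:: vd x]) x v).
Proof.
move=> s /=; rewrite -catA /=.
have E : lb (lb x x) (vd x) = 0 by rewrite lb_sq_jacobi // (sq0 (vdd x)) lb0l.
have O := @om_rel u v (lb x x) (vd x) ltac:(size_tac s).
rewrite vdd E !multilin0 // in O; c2use O; char2.
Qed.

(** Moving x across a square z'z', or across its value [z,z], has the same
    effect; this is where [lb_sq_jacobi] enters. *)
Let om_sq_letter u x z v : size (u ++ x :: lb z z :: v) = n ->
  om (u ++ x :: lb z z :: v) + om (u ++ lb z z :: x :: v) =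
  om (u ++ vd z :: lb (vd z) x :: v) + om (u ++ lb (vd z) x :: vd z :: v).
Proof.
move=> s; have O1 := @om_rel u v (lb z z) x ltac:(size_tac s).
have O2 := @om_rel u v (lb (vd z) x) (vd z) ltac:(size_tac s).
have Z1 : om (u ++ vd x :: vd (lb z z) :: v) = 0.
  by apply: multilin_mem0 => //; rewrite vd_sq mem_cat !inE eqxx !orbT.
have Z2 : om (u ++ vd (vd z) :: vd (lb (vd z) x) :: v) = 0.
  by apply: multilin_mem0 => //; rewrite vdd mem_cat mem_head orbT.
c2use O1; c2use O2; c2use Z1; c2use Z2; rewrite lb_sq_jacobi //; char2.
Qed.

Lemma confluent_overlap_swap_square u x z v :
  let w := u ++ x :: vd z :: vd z :: v in
  size w = n.+1 -> below w -> lt (vd z) x ->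
  reduct potential (Swap u x (vd z) (vd z :: v)) =
  reduct potential (Square (u ++ [:: x]) z v).
Proof.
move=> w s Bw zx; rewrite /w in s => /=; rewrite -catA /=.
have w1 := weight_swap u (vd z :: v) zx.
have w2 : (weight (u ++ vd z :: vd z :: x :: v) < weight (u ++ vd z :: x :: vd z :: v))%N.
  by have := weight_swap (u ++ [:: vd z]) v zx; rewrite -!catA.
have E1 : potential (u ++ vd z :: vd z :: x :: v) = om (u ++ lb z z :: x :: v).
  apply: (square_below Bw); first by size_tac s.
  exact: ltn_trans w2 w1.
have E2 : exchange (u ++ [:: vd z]) x (vd z) v.
  apply: (swap_below Bw) => //; first by rewrite -catA; size_tac s.
  by rewrite -catA.
move: E2; rewrite /exchange -!catA /= vdd => E2.
have O := @om_sq_letter u x z v ltac:(size_tac s).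
have P1 : potential (u ++ 0 :: vd x :: vd z :: v) = 0.
  by apply: potential0; rewrite mem_cat mem_head orbT.
have P2 : potential (u ++ vd z :: 0 :: vd x :: v) = 0.
  by apply: potential0; rewrite mem_cat !inE eqxx !orbT.
rewrite P1; rewrite P2 (lbC_closedr x (vdd z)) in E2.
rewrite (lbC_closedr x (vdd z)); c2use E1; c2use E2; c2use O; char2.
Qed.

Lemma confluent_overlap_square_swap u z x v :
  let w := u ++ vd z :: vd z :: x :: v in
  size w = n.+1 -> below w -> lt x (vd z) ->
  reduct potential (Square u z (x :: v)) =
  reduct potential (Swap (u ++ [:: vd z]) (vd z) x v).
Proof.
move=> w s Bw xz; rewrite /w in s => /=; rewrite -!catA /=.
have w1 : (weight (u ++ vd z :: x :: vd z :: v) < weight (u ++ vd z :: vd z :: x :: v))%N.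
  by have := weight_swap (u ++ [:: vd z]) v xz; rewrite -!catA.
have w2 := weight_swap u (vd z :: v) xz.
have E1 : potential (u ++ x :: vd z :: vd z :: v) = om (u ++ x :: lb z z :: v).
  have := @square_below _ (u ++ [:: x]) z v Bw; rewrite -!catA; apply.
    by size_tac s.
  exact: ltn_trans w2 w1.
have E2 : exchange u (vd z) x (vd z :: v).
  by apply: (swap_below Bw) => //; size_tac s.
have O := @om_sq_letter u x z v ltac:(size_tac s).
have P1 : potential (u ++ vd z :: vd x :: 0 :: v) = 0.
  by apply: potential0; rewrite mem_cat !inE eqxx !orbT.
have P2 : potential (u ++ vd x :: 0 :: vd z :: v) = 0.
  by apply: potential0; rewrite mem_cat !inE eqxx !orbT.
move: E2; rewrite /exchange vdd P1 P2 => E2.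
c2use E1; c2use E2; c2use O; char2.
Qed.

Lemma low_perm3 c u v x y z a b d p q r : c = open_letters (u ++ x :: y :: z :: v) ->
  perm_eq [:: a; b; d] [:: vd p; vd q; r] -> perm_eq [:: p; q; r] [:: x; y; z] ->
  low c (u ++ a :: b :: d :: v).
Proof.
move=> -> pa px; have := open_letters_vd u (r :: v) q p; rewrite /low.
have pa' : perm_eq (u ++ a :: b :: d :: v) (u ++ vd p :: vd q :: r :: v).
  rewrite perm_cat2l -[a :: _]/([:: a; b; d] ++ v).
  by rewrite -[vd p :: _]/([:: vd p; vd q; r] ++ v) perm_cat2r.
have px' : perm_eq (u ++ q :: p :: r :: v) (u ++ x :: y :: z :: v).
  rewrite perm_cat2l -[q :: _]/([:: q; p; r] ++ v).
  rewrite -[x :: _]/([:: x; y; z] ++ v) perm_cat2r.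
  apply: perm_trans px; apply/permP => P /=; lia.
by rewrite /open_letters (perm_mem pa') (permP pa') (permP px').
Qed.

(** Both ways of sorting x > y > z end in the word z y x.  The words met on the
    way with two differentiated letters have fewer open letters and are
    exchanged freely (F1 to F6); the brackets that remain are commuted with the
    third letter (O1 to O6) and add up to [lb_hexagon]. *)
Lemma confluent_overlap_swaps u x y z v :
  let w := u ++ x :: y :: z :: v in
  size w = n.+1 -> below w -> lt y x -> lt z y ->
  reduct potential (Swap u x y (z :: v)) =
  reduct potential (Swap (u ++ [:: x]) y z v).
Proof.
move=> w s Bw yx zy; have zx := lt_trans zy yx; rewrite /= -catA /=.
have Bl := below_low s Bw; rewrite /w in s Bw Bl.
have w1 := weight_swap u (z :: v) yx.
have w2 : (weight (u ++ y :: z :: x :: v) < weight (u ++ y :: x :: z :: v))%N.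
  by have := weight_swap (u ++ [:: y]) v zx; rewrite -!catA.
have w3 : (weight (u ++ x :: z :: y :: v) < weight (u ++ x :: y :: z :: v))%N.
  by have := weight_swap (u ++ [:: x]) v zy; rewrite -!catA.
have w4 := weight_swap u (y :: v) zx.
have E1 : exchange (u ++ [:: y]) x z v.
  apply: (swap_below Bw) => //; first by rewrite -catA; size_tac s.
  by rewrite -catA.
have E2 : exchange u y z (x :: v).
  apply: (swap_below Bw) => //; first by size_tac s.
  exact: ltn_trans w2 w1.
have E3 : exchange u x z (y :: v).
  by apply: (swap_below Bw) => //; size_tac s.
have E4 : exchange (u ++ [:: z]) x y v.
  apply: (swap_below Bw) => //; first by rewrite -catA; size_tac s.
  by rewrite -catA; apply: ltn_trans w4 w3.
(* The letters p and q of a rearrangement p, q, r of x, y, z are differentiated. *)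
have lo a b d p q r := @low_perm3 _ u v x y z a b d p q r erefl.
have F1 : potential (u ++ vd y :: vd x :: z :: v) + potential (u ++ vd y :: z :: vd x :: v)
    = om (u ++ vd y :: lb (vd x) z :: v).
  have := @exchange_low0 _ Bl (u ++ [:: vd y]) (vd x) z v; rewrite -!catA; apply.
  - by size_tac s.
  - by apply: (lo _ _ _ y x z); apply/permP => P /=; lia.
  - by left; exact: vdd.
have F2 : potential (u ++ vd y :: z :: vd x :: v) + potential (u ++ z :: vd y :: vd x :: v)
    = om (u ++ lb (vd y) z :: vd x :: v).
  apply: (exchange_low0 Bl); first by size_tac s.
  - by apply: (lo _ _ _ y x z); apply/permP => P /=; lia.
  - by left; exact: vdd.
have F3 : potential (u ++ y :: vd z :: vd x :: v) + potential (u ++ vd z :: y :: vd x :: v)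
    = om (u ++ lb y (vd z) :: vd x :: v).
  apply: (exchange_low0 Bl); first by size_tac s.
  - by apply: (lo _ _ _ z x y); apply/permP => P /=; lia.
  - by right; exact: vdd.
have F4 : potential (u ++ vd z :: y :: vd x :: v) + potential (u ++ vd z :: vd x :: y :: v)
    = om (u ++ vd z :: lb y (vd x) :: v).
  have := @exchange_low0 _ Bl (u ++ [:: vd z]) y (vd x) v; rewrite -!catA; apply.
  - by size_tac s.
  - by apply: (lo _ _ _ z x y); apply/permP => P /=; lia.
  - by right; exact: vdd.
have F5 : potential (u ++ vd z :: vd y :: x :: v) + potential (u ++ vd z :: x :: vd y :: v)
    = om (u ++ vd z :: lb (vd y) x :: v).
  have := @exchange_low0 _ Bl (u ++ [:: vd z]) (vd y) x v; rewrite -!catA; apply.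
  - by size_tac s.
  - by apply: (lo _ _ _ z y x); apply/permP => P /=; lia.
  - by left; exact: vdd.
have F6 : potential (u ++ vd z :: x :: vd y :: v) + potential (u ++ x :: vd z :: vd y :: v)
    = om (u ++ lb (vd z) x :: vd y :: v).
  apply: (exchange_low0 Bl); first by size_tac s.
  - by apply: (lo _ _ _ z y x); apply/permP => P /=; lia.
  - by left; exact: vdd.
have O1 := @om_rel u v (lb x y) z ltac:(size_tac s).
have O2 := @om_rel u v (lb y z) x ltac:(size_tac s).
have O3 := @om_rel u v (lb x z) y ltac:(size_tac s).
have O4 := @om_rel u v (lb (vd y) z) (vd x) ltac:(size_tac s).
have O5 := @om_rel u v (lb y (vd z)) (vd x) ltac:(size_tac s).
have O6 := @om_rel u v (lb (vd z) x) (vd y) ltac:(size_tac s).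
have om0 (a : L) : om (u ++ 0 :: a :: v) = 0 by rewrite multilin0.
rewrite vdd om0 in O4; rewrite vdd om0 in O5; rewrite vdd om0 in O6.
rewrite vd_lb omD1 in O1; rewrite vd_lb omD1 in O2; rewrite vd_lb omD1 in O3.
have H := congr1 (fun a => om (u ++ a :: v)) (lb_hexagon x y z).
rewrite !omD multilin0 // in H.
rewrite (lbC_closedr y (vdd x)) in F4.
rewrite (lbC_closed x (vdd y)) in F5.
rewrite (lbC_closedr x (vdd z)) in O3.
move: E1 E4; rewrite /exchange -!catA /= => E1 E4.
c2use E1; c2use E2; c2use E3; c2use E4.
c2use F1; c2use F2; c2use F3; c2use F4; c2use F5; c2use F6.
c2use O1; c2use O2; c2use O3; c2use O4; c2use O5; c2use O6; c2use H.
char2.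
Qed.

Lemma confluent_sym w r r' : (forall r r', redex_of w r -> redex_of w r' ->
    (redex_start r <= redex_start r')%N ->
    reduct potential r = reduct potential r') ->
  redex_of w r -> redex_of w r' -> reduct potential r = reduct potential r'.
Proof.
move=> H wr wr'; case: (leqP (redex_start r) (redex_start r')) => [|/ltnW] le.
  exact: H.
by apply: esym; apply: H.
Qed.

Lemma confluent w r r' : size w = n.+1 -> below w ->
  redex_of w r -> redex_of w r' -> reduct potential r = reduct potential r'.
Proof.
move=> s Bw; apply: confluent_sym => {}r {}r'.
case: r r' => [u x y v|u x v] [u' x' y' v'|u' x' v'] [/= lt1 src1] [/= lt2 src2] le;
  rewrite -src1 in s Bw src2; case: (cat2_eqP (esym src2)).
- by case=> -> -> -> ->.
- case=> [[uE yE vE]|[uE _ _]]; last by move: le; rewrite uE size_cat addn1 ltnn.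
  subst; exact: confluent_overlap_swaps.
- by case=> m uE vE; subst; exact: confluent_disjoint_swaps.
- by case=> m uE; move: le; rewrite uE size_cat /=; lia.
- by case=> uE xE yE; move: lt1; rewrite xE yE lt_irr.
- case=> [[uE yE vE]|[uE _ _]]; last by move: le; rewrite uE size_cat addn1 ltnn.
  by subst; exact: confluent_overlap_swap_square.
- by case=> m uE vE; subst; exact: confluent_disjoint_swap_square.
- by case=> m uE; move: le; rewrite uE size_cat /=; lia.
- by case=> uE xE yE; move: lt2; rewrite -xE -yE lt_irr.
- case=> [[uE yE vE]|[uE _ _]]; last by move: le; rewrite uE size_cat addn1 ltnn.
  by subst; exact: confluent_overlap_square_swap.
- by case=> m uE vE; subst; exact: confluent_disjoint_square_swap.
- by case=> m uE; move: le; rewrite uE size_cat /=; lia.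
- by case=> -> /(lb_sq_vd sq0) xE _ -> /=; rewrite xE.
- case=> [[uE yE vE]|[uE _ _]]; last by move: le; rewrite uE size_cat addn1 ltnn.
  subst; rewrite yE in s; rewrite /= (lb_sq_vd sq0 yE) yE.
  exact: confluent_overlap_squares s.
- by case=> m uE vE; subst; exact: confluent_disjoint_squares.
- by case=> m uE; move: le; rewrite uE size_cat /=; lia.
Qed.

(** By induction on the weight: the chosen redex gives the value of the
    potential by definition, any other one by confluence. *)
Lemma potential_consistent w : size w = n.+1 -> consistent w.
Proof.
have [N] := ubnP (weight w); elim: N w => // N IH w /ltnSE-leN s.
have Bw : below w by move=> w' s' lt'; apply: IH => //; apply: leq_trans lt' leN.
have [w0|w0] := boolP (0 \in w); first exact: consistent0.
move=> r wr; case E : (pick_redex w) => [r'|].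
  rewrite (potential_pick w0 E); apply: (confluent s Bw) => //.
  move: E; rewrite /pick_redex; case: pselect => // h [<-]; exact: svalP.
by move: E; rewrite /pick_redex; case: pselect => // h; case: h; exists r.
Qed.

Lemma potential_exchange u x y v : size (u ++ x :: y :: v) = n.+1 -> exchange u x y v.
Proof.
move=> s; apply: (@exchange_low (open_letters (u ++ x :: y :: v)).+1) => //.
  by move=> w sw _; exact: potential_consistent.
by rewrite /low ltnS leqnn orbT.
Qed.

End WordPotential.

Lemma word_potential (k : char2ClosedFieldType) (L : olieType k) (Q : lmodType k)
    (n : nat) (om : seq L -> Q) :
  (forall x : L, vd x = 0 -> lb x x = 0) -> multilinear om ->
  (forall u v (x y : L), size (u ++ x :: y :: v) = n ->
    om (u ++ x :: y :: v) + om (u ++ y :: x :: v) + om (u ++ vd y :: vd x :: v)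
    = om (u ++ lb x y :: v)) ->
  exists2 F : seq L -> Q, forall w, 0 \in w -> F w = 0 &
    forall u v (x y : L), size (u ++ x :: y :: v) = n.+1 ->
    F (u ++ x :: y :: v) + F (u ++ y :: x :: v) + F (u ++ vd y :: vd x :: v)
    = om (u ++ lb x y :: v).
Proof.
move=> sq0 om_lin om_rel; have [lt [lt_trans lt_irr lt_total]] := strict_total_order L.
exists (potential om lt) => [w|u v x y s]; first exact: potential0.
exact: (potential_exchange sq0 om_lin om_rel lt_trans lt_irr lt_total s).
Qed.

(** * The Poincare-Birkhoff-Witt theorem *)

Section MultilinearPotential.
Variables (k : char2ClosedFieldType) (L : olieType k) (Q : lmodType k).
Variables (n : nat) (om : seq L -> Q).
Hypothesis sq0 : forall x : L, vd x = 0 -> lb x x = 0.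
Hypothesis om_lin : multilinear om.
Hypothesis om_rel : forall u v (x y : L), size (u ++ x :: y :: v) = n ->
  om (u ++ x :: y :: v) + om (u ++ y :: x :: v) + om (u ++ vd y :: vd x :: v)
  = om (u ++ lb x y :: v).

(** [word_potential] made multilinear by extension from basis words.  The
    exchange relation, which is multilinear in u, x, y and v, then passes from
    basis vectors to all vectors, one argument at a time. *)
Lemma multilinear_potential : exists2 F : seq L -> Q, multilinear F &
  forall u v (x y : L), size (u ++ x :: y :: v) = n.+1 ->
    F (u ++ x :: y :: v) + F (u ++ y :: x :: v) + F (u ++ vd y :: vd x :: v)
    = om (u ++ lb x y :: v).
Proof.
have [F F0 Fex] := word_potential sq0 om_lin om_rel.
have [B [Bfree Bspan Bvd]] := differential_basis L.
pose G := multi_ext Bspan F.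
have Glin : multilinear G by exact: multi_ext_linear.
(* On basis words with letters possibly zero nothing changes; the words
   arising from basis words in the exchange relation are of this kind. *)
have GF w : (forall x, x \in w -> B x \/ x = 0) -> G w = F w.
  move=> Bw; have [w0|w0] := boolP (0 \in w); first by rewrite F0 // multilin_mem0.
  apply: multi_ext_id => // x xw; case: (Bw x xw) => // x0.
  by rewrite -x0 xw in w0.
(* The defect of the exchange relation. *)
pose D u x y v := G (u ++ x :: y :: v) + G (u ++ y :: x :: v)
  + G (u ++ vd y :: vd x :: v) + om (u ++ lb x y :: v).
pose good (w : seq L) := forall x, x \in w -> B x.
have D1 u v x y : size (u ++ x :: y :: v) = n.+1 -> good u -> B x -> B y -> good v ->
    D u x y v = 0.
  move=> s Bu Bx By Bv; rewrite /D !GF ?Fex ?Defs.addvv // => z;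
    rewrite mem_cat !inE => /or4P[/Bu|/eqP->|/eqP->|/Bv]; try by left.
    by case: (Bvd y By); [right|left].
  by case: (Bvd x Bx); [right|left].
have D_suffix u x y : multilinear (D u x y).
  have H z t : multilinear (fun w => G (u ++ z :: t :: w)).
    exact: (multilin_cons t (multilin_cons z (multilin_catl u Glin))).
  apply: multilin_add; last exact: (multilin_cons (lb x y) (multilin_catl u om_lin)).
  by apply: multilin_add => //; apply: multilin_add.
have D_prefix x y v : multilinear (fun u => D u x y v).
  apply: multilin_add; last exact: (multilin_catr (lb x y :: v) om_lin).
  apply: multilin_add; last exact: (multilin_catr _ Glin).
  by apply: multilin_add; exact: (multilin_catr _ Glin).
have lin2 (F' : seq L -> Q) u z v : multilinear F' -> linear (fun x => F' (u ++ z :: x :: v)).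
  by move=> Fl a x y; rewrite -cat_rcons Fl !cat_rcons.
have D_left u y v : linear (fun x => D u x y v).
  move=> a x x'; rewrite /D Glin linearP !lin2 // lb_linearl om_lin !scalerDr.
  char2.
have D_right u x v : linear (fun y => D u x y v).
  move=> a y y'; rewrite /D !Glin linearP lin2 // Glin lb_linearr om_lin !scalerDr.
  char2.
have D2 u v x y : size (u ++ x :: y :: v) = n.+1 -> good u -> B x -> B y ->
    D u x y v = 0.
  move=> s Bu Bx By; have := multi_zero Bspan (multilin_size (size v) (D_suffix u x y)).
  move=> /(_ _ v); rewrite eqxx; apply=> w Bw; case: eqP => // ws.
  by apply: D1 => //; rewrite -s !size_cat /= ws.
have D3 u v x y : size (u ++ x :: y :: v) = n.+1 -> B x -> B y -> D u x y v = 0.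
  move=> s Bx By; have := multi_zero Bspan (multilin_size (size u) (D_prefix x y v)).
  move=> /(_ _ u); rewrite eqxx; apply=> w Bw; case: eqP => // ws.
  by apply: D2 => //; rewrite -s !size_cat /= ws.
have D4 u v x y : size (u ++ x :: y :: v) = n.+1 -> B y -> D u x y v = 0.
  move=> s By; have := multi_zero Bspan (multilin_letter (D_left u y v)).
  move=> /(_ _ [:: x]); apply=> -[|z [|z' w]] // Bw.
  by apply: D3 => //; [rewrite -s !size_cat | apply: Bw; rewrite mem_head].
exists G => // u v x y s.
have D5 : D u x y v = 0.
  have := multi_zero Bspan (multilin_letter (D_right u x v)).
  move=> /(_ _ [:: y]); apply=> -[|z [|z' w]] // Bw.
  by apply: D4 => //; [rewrite -s !size_cat | apply: Bw; rewrite mem_head].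
by move: D5; rewrite /D => D5; c2use D5; char2.
Qed.

End MultilinearPotential.

Section TensorDegrees.
Variables (k : char2ClosedFieldType) (V : ver4Type k).
Implicit Types a b : tensor_alg V.

Lemma tspan_opp P a : tspan P a -> tspan P (- a).
Proof. by rewrite -scaleN1r; exact: tspanZ. Qed.

Lemma tspan_prod (w : seq V) : tspan (pred1 (size w)) (\prod_(x <- w) tin x).
Proof. by apply: tspan_word => /=. Qed.

Lemma tspan_pred1M i j a b : tspan (pred1 i) a -> tspan (pred1 j) b ->
  tspan (pred1 (i + j)%N) (a * b).
Proof. by move=> Ha Hb; apply: tspan_mul Ha Hb => p q /eqP-> /eqP->; exact: eqxx. Qed.

Lemma tproj_lt n b : tspan [pred i | (i < n)%N] b -> tproj n b = 0.
Proof.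
elim=> {b} [s /= sn||b b' _ Hb _ Hb'|c b _ Hb].
- by rewrite tproj_word; case: eqP => // ns; rewrite ns ltnn in sn.
- by rewrite raddf0.
- by rewrite raddfD /= Hb Hb' addr0.
- by rewrite linearZ /= Hb scaler0.
Qed.

Lemma tspan_le_sub_proj n b : tspan [pred i | (i <= n)%N] b ->
  tspan [pred i | (i < n)%N] (b - tproj n b).
Proof.
elim=> {b} [s /= sn||b b' _ Hb _ Hb'|c b _ Hb].
- rewrite tproj_word; case: eqP => [_|ns]; first by rewrite subrr; exact: tspan0.
  by rewrite subr0; apply: tspan_word => /=; lia.
- by rewrite raddf0 subrr; exact: tspan0.
- by rewrite raddfD /= opprD addrACA; exact: tspanD.
- by rewrite linearZ /= -scalerBr; exact: tspanZ.
Qed.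

Lemma tensor_sum_proj a : exists N, a = \sum_(n < N) tproj n a.
Proof.
suff [N HN] : exists N, forall M, (N <= M)%N -> a = \sum_(n < M) tproj n a.
  by exists N; apply: HN.
elim: (tspan_predT a) => {a} [s _||a b _ [N HN] _ [N' HN']|c a _ [N HN]].
- exists (size s).+1 => M sM; rewrite (bigD1 (Ordinal sM)) //= tproj_word eqxx.
  rewrite [X in _ + X]big1 ?addr0 // => i /eqP ni; rewrite tproj_word; case: eqP => // E.
  by case: ni; apply: val_inj.
- by exists 0%N => M _; rewrite big1 // => i _; rewrite raddf0.
- exists (maxn N N') => M; rewrite geq_max => /andP[NM N'M].
  by rewrite {1}(HN M NM) {1}(HN' M N'M) -big_split; apply: eq_bigr => i _; rewrite raddfD.
- exists N => M NM; rewrite {1}(HN M NM) scaler_sumr; apply: eq_bigr => i _.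
  by rewrite linearZ.
Qed.

Lemma tin_eq0 (x : V) : tin x = 0 :> tensor_alg V -> x = 0.
Proof.
move=> x0; pose F (w : seq V) := if w is [:: y] then y else 0.
have Fl : multilinear F by apply: (@multilin_letter _ _ _ idfun) => a y z.
rewrite -[LHS]/(F [:: x]) -(tensor_ext_word Fl) big_seq1 x0.
by have := tensor_ext_linear Fl (-1) 0 0; rewrite scaler0 addr0 scaleN1r addNr.
Qed.

Lemma prod_tin_multilinear :
  multilinear (fun w => \prod_(x <- w) tin x : tensor_alg V).
Proof.
move=> u v a x y; rewrite !big_cat !big_cons /= linearP /=.
by rewrite mulrDl mulrDr -scalerAl -scalerAr.
Qed.

End TensorDegrees.

Section FilteredIdeal.
Variables (k : char2ClosedFieldType) (L : olieType k).
Local Notation TL := (tensor_alg L).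
Implicit Types (a b c : TL) (m n : nat).

(** The subspace J_m.  It is smaller a priori than the part of degree at most
    [m] of the ideal of U(L), where terms of higher degree may cancel. *)
Inductive env_rels m : TL -> Prop :=
| er_rel i j a b x y : tspan (pred1 i) a -> tspan (pred1 j) b -> (i + j + 2 <= m)%N ->
    env_rels m (a * env_rel x y * b)
| er0 : env_rels m 0
| erD a b : env_rels m a -> env_rels m b -> env_rels m (a + b)
| erZ (e : k) a : env_rels m a -> env_rels m (e *: a).

Lemma env_rels_vd m a : env_rels m a -> env_rels m (vd a).
Proof.
elim=> {a} [i j a b x y Ha Hb le||a b _ Ha _ Hb|c a _ Ha].
- have dist (r s : TL) : a * (r + s) * b = a * r * b + a * s * b.
    by rewrite mulrDr mulrDl.
  rewrite !vdM env_rel_vd mulrDl dist.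
  apply: erD; last exact: er_rel Ha (tspan_vd Hb) le.
  apply: erD; first exact: er_rel (tspan_vd Ha) Hb le.
  by apply: erD; exact: er_rel Ha Hb le.
- by rewrite raddf0; exact: er0.
- by rewrite raddfD; exact: erD.
- by rewrite linearZ; exact: erZ.
Qed.

Definition env_rels_so m : subobj TL :=
  SubObj (@er0 m) (@erD m) (@erZ m) (@env_rels_vd m).

Lemma env_rels_le m n a : (m <= n)%N -> env_rels m a -> env_rels n a.
Proof.
move=> mn; elim=> {a} [i j a b x y Ha Hb le||a b _ Ha _ Hb|c a _ Ha].
- exact: er_rel Ha Hb (leq_trans le mn).
- exact: er0.
- exact: erD.
- exact: erZ.
Qed.

Lemma env_ideal_rels a : rel_so (@env_rel_vd k L) a -> exists m, env_rels m a.
Proof.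
have er_mul b c m x : env_rels m x -> exists m', env_rels m' (b * x * c).
  move=> Hx.
  elim: (tspan_predT b) => {b} [s _||b b' _ [p Hp] _ [q Hq]|e b _ [p Hp]]; last 3 first.
  - by exists 0%N; rewrite !mul0r; exact: er0.
  - exists (maxn p q); rewrite !mulrDl; apply: erD.
      exact: env_rels_le (leq_maxl _ _) Hp.
    exact: env_rels_le (leq_maxr _ _) Hq.
  - by exists p; rewrite -!scalerAl; exact: erZ.
  elim: (tspan_predT c) => {c} [s' _||c c' _ [p Hp] _ [q Hq]|e c _ [p Hp]]; last 3 first.
  - by exists 0%N; rewrite !mulr0; exact: er0.
  - exists (maxn p q); rewrite !mulrDr; apply: erD.
      exact: env_rels_le (leq_maxl _ _) Hp.
    exact: env_rels_le (leq_maxr _ _) Hq.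
  - by exists p; rewrite -!scalerAr; exact: erZ.
  exists (size s + m + size s')%N.
  elim: Hx => {x} [i j b c x y Hb Hc le||x y _ Hx _ Hy|e x _ Hx].
  - rewrite !mulrA -[_ * c * _]mulrA.
    apply: (@er_rel _ (size s + i) (j + size s')); last by lia.
      exact: tspan_pred1M (tspan_prod s) Hb.
    exact: tspan_pred1M Hc (tspan_prod s').
  - by rewrite mulr0 mul0r; exact: er0.
  - by rewrite mulrDr mulrDl; exact: erD.
  - by rewrite -scalerAr -scalerAl; exact: erZ.
elim=> {a} [_ [x [y ->]]||a b _ [p Hp] _ [q Hq]|a x _ [m Hm]|a x _ [m Hm]].
- exists 2%N; rewrite -[env_rel x y]mul1r -[1 * _]mulr1.
  have T1 : tspan (pred1 0%N) (1 : TL).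
    by rewrite -(big_nil 1%R *%R predT (@tin k L)); exact: tspan_word.
  exact: (er_rel _ _ T1 T1).
- by exists 0%N; exact: er0.
- exists (maxn p q); apply: erD.
    exact: env_rels_le (leq_maxl _ _) Hp.
  exact: env_rels_le (leq_maxr _ _) Hq.
- by have [m' Hm'] := er_mul a 1 m x Hm; exists m'; rewrite mulr1 in Hm'.
- by have [m' Hm'] := er_mul 1 a m x Hm; exists m'; rewrite mul1r in Hm'.
Qed.

Lemma env_rel_word u v (x y : L) :
  \prod_(z <- u) tin z * env_rel x y * \prod_(z <- v) tin z =
  \prod_(z <- u ++ x :: y :: v) tin z + \prod_(z <- u ++ y :: x :: v) tin z
  + \prod_(z <- u ++ vd y :: vd x :: v) tin z + \prod_(z <- u ++ lb x y :: v) tin z.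
Proof.
rewrite !big_cat !big_cons /= /env_rel /mulc !vd_tin !oppv.
by rewrite !(mulrDr, mulrDl) !mulrA; char2.
Qed.

(** A relation a r b with deg a + deg b + 2 = n has as its component of degree n
    the corresponding relation of Sym L, and the others have none. *)
Lemma env_rels_lead n a : env_rels n a -> rel_so (@sym_rel_vd k L) (tproj n a).
Proof.
elim=> {a} [i j a b x y Ha Hb le||a b _ Ha _ Hb|c a _ Ha]; last 3 first.
- by rewrite raddf0; exact: ig0.
- by rewrite raddfD; exact: igD.
- by rewrite linearZ; exact: (@soZ _ _ (rel_so (@sym_rel_vd k L))).
have -> : a * env_rel x y * b = a * sym_rel x y * b + a * tin (lb x y) * b.
  rewrite -mulrDl -mulrDr; congr (_ * _ * _); rewrite /env_rel /sym_rel !oppv.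
  by rewrite (addrC (mulc _ _)).
have H2 : tspan (pred1 (i + 2 + j)%N) (a * sym_rel x y * b).
  exact: tspan_pred1M (tspan_pred1M Ha (sym_rel_span x y)) Hb.
have H1 : tspan (pred1 (i + 1 + j)%N) (a * tin (lb x y) * b).
  exact: tspan_pred1M (tspan_pred1M Ha (tspan_tin _)) Hb.
rewrite raddfD /= (tproj_hom _ H2) (tproj_hom _ H1).
have -> : (n == i + 1 + j)%N = false by apply/eqP; lia.
rewrite addr0; case: ifP => _; last exact: ig0.
by apply: ig_mulr; apply: ig_mull; apply: ig_in; exists x, y.
Qed.

Hypothesis sq0 : forall x : L, vd x = 0 -> lb x x = 0.

(** The linear map [G] is the projection modulo J_n in degrees other than [n.+1],
    and the multilinear potential in degree [n.+1]; it kills J_(n+1) by the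
    exchange relation. *)
Lemma env_rels_descend n a : env_rels n.+1 a -> tspan [pred i | (i <= n)%N] a ->
  env_rels n a.
Proof.
pose J := env_rels_so n.
pose om (w : seq L) : quot_of J := qpi J (\prod_(x <- w) tin x).
have om_lin : multilinear om.
  by move=> u v c x y; rewrite /om prod_tin_multilinear linearP.
have om_word u v (x y : L) : (size u + size v + 2 <= n)%N ->
    om (u ++ x :: y :: v) + om (u ++ y :: x :: v) + om (u ++ vd y :: vd x :: v)
    = om (u ++ lb x y :: v).
  move=> s; have : qpi J (\prod_(z <- u) tin z * env_rel x y * \prod_(z <- v) tin z) = 0.
    by apply/qpi0P; apply: er_rel s; apply: tspan_word => /=.
  by rewrite env_rel_word !raddfD => E; c2use E; char2.
have om_rel u v (x y : L) : size (u ++ x :: y :: v) = n ->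
    om (u ++ x :: y :: v) + om (u ++ y :: x :: v) + om (u ++ vd y :: vd x :: v)
    = om (u ++ lb x y :: v).
  by rewrite size_cat /= => s; apply: om_word; lia.
have [F Fl Fex] := multilinear_potential sq0 om_lin om_rel.
pose P (w : seq L) : quot_of J := if size w == n.+1 then F w else om w.
have Pl : multilinear P.
  by move=> u v c x y; rewrite /P !size_cat /= Fl om_lin; case: ifP.
pose G := tensor_ext P.
have GD : {morph G : b c / b + c}.
  by move=> b c; have := tensor_ext_linear Pl 1 b c; rewrite !scale1r.
have G0 : G 0 = 0 by apply: (addrI (G 0)); rewrite -GD !addr0.
have GZ (c : k) b : G (c *: b) = c *: G b.
  by have := tensor_ext_linear Pl c b 0; rewrite -/G G0 !addr0.
have Grel b : env_rels n.+1 b -> G b = 0.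
  elim=> {b} [i j b c x y Hb Hc le||b c _ Hb _ Hc|e b _ Hb]; last 3 first.
  - exact: G0.
  - by rewrite GD Hb Hc addr0.
  - by rewrite GZ Hb scaler0.
  elim: Hb => {b} [s /eqP si||b b' _ Hb _ Hb'|e b _ Hb]; last 3 first.
  - by rewrite !mul0r G0.
  - by rewrite (mulrDl b b') (mulrDl _ _ c) GD Hb Hb' addr0.
  - by rewrite -!scalerAl GZ Hb scaler0.
  elim: Hc => {c} [s' /eqP sj||c c' _ Hc _ Hc'|e c _ Hc]; last 3 first.
  - by rewrite !mulr0 G0.
  - by rewrite (mulrDr _ c c') GD Hc Hc' addr0.
  - by rewrite -!scalerAr GZ Hc scaler0.
  rewrite -{}si -{}sj in le.
  rewrite env_rel_word !GD /G !tensor_ext_word // /P !size_cat /=.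
  have -> : (size s + (size s').+1 == n.+1)%N = false by apply/eqP; lia.
  have [sn|sn] := eqVneq (size s + (size s').+2)%N n.+1.
    by rewrite Fex ?Defs.addvv // size_cat.
  have sl : (size s + size s' + 2 <= n)%N.
    by move: (size s) (size s') le sn => p q; lia.
  by rewrite (om_word _ _ _ _ sl) Defs.addvv.
have Glow b : tspan [pred i | (i <= n)%N] b -> G b = qpi J b.
  elim=> {b} [s /= sn||b c _ Hb _ Hc|e b _ Hb].
  - rewrite /G tensor_ext_word // /P; have -> // : (size s == n.+1) = false.
    by apply/negbTE; rewrite neq_ltn ltnS sn.
  - by rewrite G0 raddf0.
  - by rewrite GD Hb Hc raddfD.
  - by rewrite GZ Hb linearZ.
by move=> Ha la; apply/(@qpi0P _ _ J); rewrite -Glow // Grel.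
Qed.

Lemma env_ideal_filtered n a : rel_so (@env_rel_vd k L) a ->
  tspan [pred i | (i <= n)%N] a -> env_rels n a.
Proof.
move=> /env_ideal_rels[m]; elim: m => [|m IH] Ha la; first exact: env_rels_le Ha.
have [mn|nm] := leqP m.+1 n; first exact: env_rels_le Ha.
apply: IH => //; apply: env_rels_descend => //.
by apply: tspan_sub la => i /= /leq_trans; apply.
Qed.

Lemma env_pi_eq0 a : env_pi a = 0 <-> rel_so (@env_rel_vd k L) a.
Proof. exact: (@qpi0P k TL (rel_so (@env_rel_vd k L))). Qed.

Lemma sym_pi_eq0 a : sym_pi a = 0 <-> rel_so (@sym_rel_vd k L) a.
Proof. exact: (@qpi0P k TL (rel_so (@sym_rel_vd k L))). Qed.

(** L embeds in U(L), because J_1 is zero. *)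
Lemma env_tin_eq0 (x : L) : env_pi (tin x) = 0 -> x = 0.
Proof.
move=> /env_pi_eq0 I.
have /(env_ideal_filtered I) : tspan [pred i | (i <= 1)%N] (tin x : TL).
  by apply: tspan_sub (tspan_tin x) => i /eqP->.
suff er1 b : env_rels 1 b -> b = 0 by move=> /er1; exact: tin_eq0.
elim=> {b} [i j b c y z _ _|//|b c _ -> _ ->|e b _ ->]; last 2 first.
- by rewrite addr0.
- by rewrite scaler0.
by rewrite addn2.
Qed.

(** If the degree n component of a has lower filtration in U(L), it differs by
    some b of degree less than n from an element of the ideal, whose leading
    term it therefore is. *)
Lemma eta_injective : injective (@eta k L).
Proof.
move=> p q /eqP; rewrite -subr_eq0 -raddfB /= => /eqP E; apply/eqP; rewrite -subr_eq0.
move: (p - q) E => {p q} p; have [a pE] := aqpi_surj p.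
rewrite [p](pE : p = sym_pi a) eta_sym_pi => E.
have Ha n : rel_so (@sym_rel_vd k L) (tproj n a).
  have /eta_comp0P[b lb_ /eqP] : eta_comp n a = 0.
    exact: (congr1 (fun f => sval f n) E).
  rewrite -subr_eq0 -raddfB => /eqP/env_pi_eq0 I.
  have := env_rels_lead (@env_ideal_filtered n _ I _).
  rewrite raddfB /= (tproj_lt lb_) subr0 (tproj_hom _ (tproj_span n a)) eqxx; apply.
  apply: tspanD; first by apply: tspan_sub (tproj_span n a) => i /eqP->; exact: leqnn.
  by apply: tspan_opp; apply: tspan_sub lb_ => i /=; exact: ltnW.
apply/eqP/sym_pi_eq0; have [N ->] := tensor_sum_proj a.
elim/big_ind: _ => [|b c|i _]; [exact: ig0|exact: igD|exact: Ha].
Qed.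

End FilteredIdeal.

Lemma eta_surjective (k : char2ClosedFieldType) (L : olieType k)
  (f : dsum (env_gr L)) : exists q, eta q = f.
Proof.
have lift n : exists b : tensor_alg L,
    forall c, env_pi (tproj n c) = env_pi (tproj n b) -> eta_comp n c = sval f n.
  have [u uE] := qpi_surj (sval f n).
  have [b lb_ ubE] := subP u; exists b => c cE.
  rewrite uE /eta_comp; apply/qpi_eqP => /=; rewrite cE ubE -raddfB.
  exists (tproj n b - b) => //; rewrite -opprB; apply: tspan_opp.
  exact: tspan_le_sub_proj.
have [b Hb] := choice lift.
have [N HN] := svalP f.
exists (sym_pi (\sum_(n < N) tproj n (b n))); rewrite eta_sym_pi; apply: dsumP => n /=.
have pE : tproj n (\sum_(m < N) tproj m (b m)) = if (n < N)%N then tproj n (b n) else 0.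
  rewrite raddf_sum; case: ifP => nN.
    rewrite (bigD1 (Ordinal nN)) //= (tproj_hom _ (tproj_span _ _)) eqxx.
    rewrite big1 ?addr0 // => i /eqP ni; rewrite (tproj_hom _ (tproj_span _ _)).
    by case: eqP => // E; case: ni; apply: val_inj.
  rewrite big1 // => i _ /=; rewrite (tproj_hom _ (tproj_span _ _)).
  by case: eqP => // E; rewrite E ltn_ord in nN.
have [nN|nN] := ltnP n N.
  by apply: Hb; rewrite pE nN.
rewrite HN //; apply/eta_comp0P; rewrite pE ltnNge nN /= raddf0.
exact: (@so0 _ _ (env_fil L _)).
Qed.

(** Both sides are morphisms of operadic Lie algebras from FOLie(L) to U(L)
    that agree on L. *)
Lemma env_lie_phi (k : char2ClosedFieldType) (L : olieType k) (a : free_olie L) :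
  env_pi (lie_phi a) = env_pi (tin (lie_beta a)).
Proof.
have phiD b c : lie_phi (b + c) = lie_phi b + lie_phi c :> tensor_alg L.
  by have := lie_phi_linear 1 b c; rewrite !scale1r.
have phi0 : lie_phi 0 = 0 :> tensor_alg L.
  by apply: (addrI (lie_phi (0 : free_olie L) : tensor_alg L)); rewrite -phiD !addr0.
have phiZ e b : lie_phi (e *: b) = e *: (lie_phi b : tensor_alg L).
  by have := lie_phi_linear e b 0; rewrite phi0 !addr0.
have betaD b c : lie_beta (b + c) = lie_beta b + lie_beta c :> L.
  by have := lie_beta_linear 1 b c; rewrite !scale1r.
have beta0 : lie_beta 0 = 0 :> L.
  by apply: (addrI (lie_beta (0 : free_olie L))); rewrite -betaD !addr0.
have betaZ e b : lie_beta (e *: b) = e *: (lie_beta b : L).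
  by have := lie_beta_linear e b 0; rewrite beta0 !addr0.
elim/free_olie_ind: a => [x||b c Hb Hc|e b Hb|b c Hb Hc].
- by rewrite lie_phi_lin lie_beta_lin.
- by rewrite phi0 beta0 !linear0.
- by rewrite phiD betaD !raddfD /= Hb Hc.
- by rewrite phiZ betaZ !linearZ /= Hb.
rewrite lie_phi_lb lie_beta_lb -[lb (lie_phi b) _]/(comm_lb _ _) /comm_lb /mulc.
have E (p q : tensor_alg L) : env_pi (p * q - (q * p + vd q * vd p)) =
    env_pi p * env_pi q - (env_pi q * env_pi p + vd (env_pi q) * vd (env_pi p)).
  by rewrite !vd_aqpi raddfB raddfD /= !rmorphM.
rewrite E Hb Hc -E; apply/subr0_eq; rewrite -raddfB; exact: env_pi_rel.
Qed.

Theorem corollary3p4 (k : char2ClosedFieldType) (L : olieType k) :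
  is_lie L /\ satisfies_PBW L <-> (forall x : L, vd x = 0 -> lb x x = 0).
Proof.
split=> [[L_lie _] x x0|sq0]; last split.
- rewrite -[x]lie_beta_lin -lie_beta_lb; apply: (L_lie 2%N) => //; split.
    exact: (@fd_lb _ _ 1 1 _ _ (fd_lin x) (fd_lin x)).
  rewrite lie_phi_lb lie_phi_lin -[LHS]/(comm_lb _ _) /comm_lb /mulc vd_tin x0.
  by rewrite linear0 mul0r addr0 subrr.
- move=> n a _ [_ phi0]; apply: (env_tin_eq0 sq0).
  by rewrite -env_lie_phi phi0 linear0.
- have [g gK] := choice (@eta_surjective k L).
  exists g => // p; apply: (eta_injective sq0); exact: gK.
Qed.
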